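(* For every integer $n\ge4$ and every $f:\mathbb Z_n\to[0,\infty)$ satisfying $\pi(f^2)=1$, $$2\,\mathcal E_n(f)-\operatorname{Ent}_\pi(f^2)\ge\frac1{12}\|f-1\|_{L^2(\pi)}^4 .\qquad\text{(a)}$$ More generally, for every $d\ge1$, with $G=(\mathbb Z_n)^d$, $\mu=\pi^{\otimes d}$ and $A=\sum_{i=1}^dA_{\psi_n}^{(i)}$, every $f:G\to[0,\infty)$ satisfying $\int_G f^2\,d\mu=1$ obeys $$2\int_G f\,Af\,d\mu-\operatorname{Ent}_\mu(f^2)\ge\frac1{12d}\|f-1\|_{L^2(\mu)}^4 .\qquad\text{(b)}$$ Moreover, the exponent $4$ in (a) and the $d^{-1}$ dependence in (b) are optimal.
   Context: $\mathbb Z_n=\mathbb Z/n\mathbb Z$ is equipped with the uniform probability measure $\pi$; write $\pi(f)=\frac1n\sum_{x\in\mathbb Z_n}f(x)$. For a probability measure $\nu$ and $g\ge0$, $\operatorname{Ent}_\nu(g)=\int g\log g\,d\nu-\left(\int g\,d\nu\right)\log\left(\int g\,d\nu\right)$, with the convention $0\log 0=0$. Fourier coefficients on $\mathbb Z_n$ are $\widehat f(k)=\frac1n\sum_{x\in\mathbb Z_n}f(x)e^{-2\pi i kx/n}$. The word length is $\psi_n(k)=\min(k,n-k)$ for $k\in\{0,\dots,n-1\}$. The word-length Laplacian is $A_{\psi_n}f(x)=\sum_{k=0}^{n-1}\psi_n(k)\widehat f(k)e^{2\pi i kx/n}$, and its Dirichlet form is $\mathcal E_n(f)=\pi(\overline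 f\,A_{\psi_n}f)=\sum_{k=0}^{n-1}\psi_n(k)|\widehat f(k)|^2$. On $(\mathbb Z_n)^d$, $A_{\psi_n}^{(i)}$ denotes $A_{\psi_n}$ acting in the $i$-th coordinate with the other coordinates fixed: $(A_{\psi_n}^{(i)}h)(x_1,\dots,x_d)=\left[A_{\psi_n}h(x_1,\dots,x_{i-1},\cdot,x_{i+1},\dots,x_d)\right](x_i)$. *)

(* Defs.v *)
From HB Require Import structures.
From mathcomp Require Import all_boot all_order all_algebra.
From mathcomp Require Import all_classical all_reals.
From mathcomp Require Import normedtype exp trigo.
From mathcomp Require Import complex.
Set Implicit Arguments.
Unset Strict Implicit.
Unset Printing Implicit Defensive.
Import Order.TTheory GRing.Theory Num.Theory.
Local Open Scope ring_scope.
Local Open Scope complex_scope.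

(* Probability measures on finite sets are given by their mass functions. *)
Section FiniteMeasure.
Variables (R : realType) (T : finType) (nu : T -> R).

Definition fin_integral (g : T -> R) : R := \sum_x nu x * g x.

Definition fin_cintegral (g : T -> R[i]) : R[i] := \sum_x (nu x)%:C * g x.

(* The convention 0 log 0 = 0 is automatic, [ln 0] being a real number (0). *)
Definition Ent (g : T -> R) : R :=
  fin_integral (fun x => g x * ln (g x)) - fin_integral g * ln (fin_integral g).

Definition L2norm (g : T -> R) : R :=
  Num.sqrt (fin_integral (fun x => `|g x| ^+ 2)).

End FiniteMeasure.

Section Circle.
Variable R : realType.

Definition expi (t : R) : R[i] := cos t +i* sin t.

(* For n > 1 the elements of 'Z_n are the representatives 0, ..., n - 1, seen
   as natural numbers through the ordinal coercion; what follows is only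
   meaningful for such n. *)
Definition unif (n : nat) (x : 'Z_n) : R := n%:R^-1.

Definition fourier (n : nat) (f : 'Z_n -> R[i]) (k : 'Z_n) : R[i] :=
  n%:R^-1 * \sum_x f x * expi (- (2 * pi * (k : nat)%:R * (x : nat)%:R / n%:R)).

Definition word_length (n : nat) (k : 'Z_n) : nat := minn k (n - k).

Definition lap (n : nat) (f : 'Z_n -> R[i]) (x : 'Z_n) : R[i] :=
  \sum_k (word_length k)%:R * fourier f k
         * expi (2 * pi * (k : nat)%:R * (x : nat)%:R / n%:R).

Definition dirichlet (n : nat) (f : 'Z_n -> R[i]) : R[i] :=
  fin_cintegral (@unif n) (fun x => (f x)^* * lap f x).

Lemma dirichletE (n : nat) (f : 'Z_n -> R[i]) :
  dirichlet f = \sum_k (word_length k)%:R * `|fourier f k| ^+ 2.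
Proof.
rewrite /dirichlet /fin_cintegral /lap.
under eq_bigr => x _ do rewrite mulr_sumr mulr_sumr.
rewrite exchange_big; apply: eq_bigr => k _ /=.
rewrite (normCK (fourier f k)) [RHS]mulrA.
have -> : Num.conj (fourier f k) = \sum_x n%:R^-1 * ((f x)^*
    * expi (2 * pi * (k : nat)%:R * (x : nat)%:R / n%:R)).
  rewrite {1}/fourier rmorphM /= fmorphV /= rmorph_nat rmorph_sum /= mulr_sumr.
  apply: eq_bigr => x _; rewrite rmorphM /=; congr (_ * (_ * _)).
  rewrite /expi cosN sinN.
  by apply/eqP; rewrite eq_complex /= opprK !eqxx.
rewrite [RHS]mulr_sumr; apply: eq_bigr => x _.
have -> : (unif x)%:C = n%:R^-1 :> R[i] by rewrite /unif fmorphV rmorph_nat.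
by rewrite [RHS]mulrCA; congr (_ * _); rewrite [RHS]mulrCA.
Qed.

Definition lap_coord (n d : nat) (i : 'I_d) (h : {ffun 'I_d -> 'Z_n} -> R[i])
    (x : {ffun 'I_d -> 'Z_n}) : R[i] :=
  lap (fun y : 'Z_n => h [ffun j => if j == i then y else x j]) (x i).

Definition lap_prod (n d : nat) (h : {ffun 'I_d -> 'Z_n} -> R[i])
    (x : {ffun 'I_d -> 'Z_n}) : R[i] :=
  \sum_(i < d) lap_coord i h x.

Definition unif_prod (n d : nat) (x : {ffun 'I_d -> 'Z_n}) : R :=
  \prod_(i < d) unif (x i).

End Circle.
Arguments unif R n x : clear implicits.
Arguments unif_prod R n d x : clear implicits.

(* Main.v *)
Require Import Defs.
From HB Require Import structures.
From mathcomp Require Import all_boot all_order all_algebra.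
From mathcomp Require Import all_classical all_reals.
From mathcomp Require Import normedtype exp trigo.
From mathcomp Require Import complex.
From mathcomp Require Import topology derive realfun.
From mathcomp Require Import zify ring lra.
Set Implicit Arguments.
Unset Strict Implicit.
Unset Printing Implicit Defensive.
Import Order.TTheory GRing.Theory Num.Theory.
Local Open Scope ring_scope.
Local Open Scope complex_scope.

(** Normalise [pi(f^2) = 1] and put [e = pi(f)], [g = f - e], [s = pi(g^2) =
    1 - e^2].  The third order Taylor polynomial of [u^2 ln u] at [u = 1]
    dominates it up to a quartic remainder, so [Ent(f^2)] is bounded by
    [pi(f^3)], [pi(f^2)] and [pi(f)], and the remainder produces the stability
    term by Jensen.  What is left is the cubic inequality [pi(g^3) <=
    3 (E(g) - s) + 3/4 s^2].  In Fourier coefficients [pi(g^3)] is a sum over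
    triples [j + k + l = 0]; let [l] be the frequency of largest word length [L].
    By AM-GM the term is at most [(|g^_l|^2 + |g^_j|^2 |g^_k|^2) / 2]: the first
    parts are counted at most [2 (L - 1)] times, and [j, k] lie on the same side
    of [n / 2], so that the second parts sum to at most [s^2 / 2].

    The word length is [floor(n/2)] minus the autocorrelation of a half circle,
    hence the Dirichlet form is [c |f|^2] minus a quadratic form with
    nonnegative coefficients and decreases when [f] is replaced by its partial
    [L^2] norms.  With the chain rule for the entropy, the deficits of the
    coordinates then add up, the gaps [|.|_2 - |.|_1] telescope, and
    Cauchy-Schwarz over the [d] coordinates costs the factor [1 / d].  Optimality
    is seen on [1 + eta * 2 cos(2 pi x / n)] and its tensor powers. *)

(** * Rational bounds for the logarithm *)

Section LnBounds.
Import numFieldNormedType.Exports.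
Local Open Scope classical_set_scope.

(** [D] decreases up to 1 and increases afterwards, so its minimum is at 1. *)
Lemma ge0_of_derive_sign (R : realType) (D D' : R -> R) :
  D 1 = 0 ->
  (forall u : R, 0 < u -> is_derive u 1 D (D' u)) ->
  (forall u : R, 0 < u -> 0 <= (u - 1) * D' u) ->
  forall u : R, 0 < u -> 0 <= D u.
Proof.
move=> D1 dD sD u u0.
have cD a b : 0 < a -> {within `[a, b], continuous D}.
  move=> a0; apply: derivable_within_continuous => x; rewrite in_itv /= => /andP[ax _].
  by apply: ex_derive; apply: dD; exact: lt_le_trans ax.
have dv x : 0 < x -> derivable D x 1 by move=> x0; apply: ex_derive; apply: dD.
have dE x : 0 < x -> D^`() x = D' x.
  by move=> x0; rewrite derive1E; have [_ ->] := dD x x0.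
case: (leP 1 u) => u1; rewrite -D1.
- apply: (@ger0_derive1_le_cc _ D 1 u) => //.
  + by move=> x; rewrite in_itv /= => /andP[x1 _]; apply: dv; lra.
  + move=> x; rewrite in_itv /= => /andP[x1 _].
    rewrite dE; last lra.
    by have := sD x ltac:(lra); rewrite pmulr_rge0 //; lra.
  + by apply: cD; lra.
  + by rewrite in_itv /= lexx.
  + by rewrite in_itv /= lexx u1.
- apply: (@ler0_derive1_le_cc _ D u 1) => //.
  + by move=> x; rewrite in_itv /= => /andP[x1 _]; apply: dv; lra.
  + move=> x; rewrite in_itv /= => /andP[x1 x2].
    rewrite dE; last lra.
    by have := sD x ltac:(lra); rewrite nmulr_rge0 //; lra.
  + exact: cD.
  + by rewrite in_itv /= lexx ltW.
  + by rewrite in_itv /= lexx (ltW u1).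
  + exact: ltW.
Qed.

(** A common shape for the partial fractions of the two rational bounds below; the pole at - 3/2
    occurs only in the upper one. *)
Lemma is_derive_ratB_ln (R : realType) (a b c d e k x : R) : 0 < x ->
  is_derive x 1 (fun u : R => a * u ^+ 2 + b * u + c + d * u^-1 + e * (u ^+ 2)^-1
                   + k * (2 * u + 3)^-1 - ln u)
    (2 * a * x + b - d / x ^+ 2 - 2 * e / x ^+ 3 - 2 * k / (2 * x + 3) ^+ 2 - x^-1).
Proof.
move=> x0.
have x1 : x != 0 by rewrite gt_eqF.
have x2 : x ^+ 2 != 0 by rewrite expf_neq0.
have x3 : 2 * x + 3 != 0 by rewrite gt_eqF //; lra.
have dl := is_derive1_ln x0.
have eqd (f : R -> R) (p q : R) : is_derive x 1 f p -> p = q -> is_derive x 1 f q by move=> ? <-.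
have did : is_derive x 1 (fun u : R => u) 1 by exact: is_derive_id.
have dc (z : R) : is_derive x 1 (fun u : R => z) 0 by exact: is_derive_cst.
have d2 : is_derive x 1 (fun u : R => u ^+ 2) (2 * x).
  by apply: eqd (is_deriveM did did) _; rewrite /GRing.scale /=; ring.
have dm (f : R -> R) (z f' : R) : is_derive x 1 f f' -> is_derive x 1 (fun u : R => z * f u) (z * f').
  by move=> h; exact: (is_deriveZ (f := f) z).
have d3 : is_derive x 1 (fun u : R => 2 * u + 3) 2.
  by apply: eqd (is_deriveD (dm _ 2 _ did) (dc 3)) _; ring.
have dV (f : R -> R) (f' : R) : f x != 0 -> is_derive x 1 f f' ->
    is_derive x 1 (fun u : R => (f u)^-1) (- f' / f x ^+ 2).
  move=> fx h; apply: eqd (is_deriveV fx h) _.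
  by rewrite /GRing.scale /=; field.
have H := is_deriveB (is_deriveD (is_deriveD (is_deriveD (is_deriveD (is_deriveD (dm _ a _ d2)
  (dm _ b _ did)) (dc c)) (dm _ d _ (dV (fun u => u) _ x1 did)))
  (dm _ e _ (dV (fun u => u ^+ 2) _ x2 d2)))
  (dm _ k _ (dV (fun u => 2 * u + 3) _ x3 d3))) dl.
apply: eqd H _; by field; rewrite x1 x3.
Qed.

(* The right-hand side agrees with [ln] to fifth order at 1; the derivative of
   the difference is [(u - 1)^5 / (2 u^3 (2 u + 3)^2)]. *)
Lemma ln_le_rat (R : realType) (u : R) : 0 < u ->
  ln u <= (3 * u ^+ 4 + 44 * u ^+ 3 - 36 * u ^+ 2 - 12 * u + 1) / (12 * u ^+ 2 * (2 * u + 3)).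
Proof.
move=> u0.
(* The coefficients are the partial fractions of the right-hand side. The derivative at 1 is then
   invoked only to read [D] off its statement. *)
have dR := @is_derive_ratB_ln R 0 (1 / 8) (79 / 48) (- 19 / 54) (1 / 36) (- 3125 / 432).
have := dR 1 ltr01; set D := (X in is_derive _ _ X _) => _.
have dD (x : R) : 0 < x -> is_derive x 1 D _ := dR x.
have den (x : R) : 0 < x -> (x != 0) && (2 * x + 3 != 0 :> R).
  by move=> x0; rewrite !gt_eqF //; lra.
have : 0 <= D u.
  apply: (ge0_of_derive_sign _ dD) => [|x x0|//]; first by rewrite /D ln1; field.
  rewrite (_ : _ * _ = (x - 1) ^+ 6 / (2 * x ^+ 3 * (2 * x + 3) ^+ 2)); last first.
    by have /andP[x1 x2] := den _ x0; field; rewrite x1 x2.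
  apply: divr_ge0; first by rewrite (exprM _ 2 3) exprn_ge0 ?sqr_ge0.
  by rewrite !mulr_ge0 ?exprn_ge0 ?ltW //; lra.
rewrite subr_ge0 => /le_trans; apply; rewrite le_eqVlt; apply/orP; left; apply/eqP.
by have /andP[x1 x2] := den _ u0; field; rewrite x1 x2.
Qed.

(* The derivative of the difference is [(u - 1)^3 / (3 u^2)]. *)
Lemma ln_ge_rat (R : realType) (u : R) : 0 < u ->
  (- u ^+ 2 + 6 * u - 3 - 2 / u) / 6 <= ln u.
Proof.
move=> u0.
have dR := @is_derive_ratB_ln R (- 1 / 6) 1 (- 1 / 2) (- 1 / 3) 0 0.
have := dR 1 ltr01; set D := (X in is_derive _ _ X _) => _.
have dD (x : R) : 0 < x -> is_derive x 1 D _ := dR x.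
have dN (x : R) : 0 < x -> is_derive x 1 (fun u => - D u) _ := fun x0 => is_deriveN (dD x x0).
have : 0 <= - D u.
  apply: (ge0_of_derive_sign _ dN) => [|x x0|//]; first by rewrite /D ln1; field.
  have x1 : x != 0 by rewrite gt_eqF.
  have x2 : 2 * x + 3 != 0 by rewrite gt_eqF //; lra.
  rewrite (_ : _ * _ = (x - 1) ^+ 4 / (3 * x ^+ 2)); last by field; rewrite x1 x2.
  apply: divr_ge0; first by rewrite (exprM _ 2 2) sqr_ge0.
  by rewrite mulr_ge0 ?exprn_ge0 //; lra.
have x1 : u != 0 by rewrite gt_eqF.
have x2 : 2 * u + 3 != 0 by rewrite gt_eqF //; lra.
rewrite oppr_ge0 subr_le0; apply: le_trans.
by rewrite le_eqVlt; apply/orP; left; apply/eqP; field; rewrite x1 x2.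
Qed.

(* The remainder should be [(u - 1)^4 / 24], which is too large for large [u];
   its tangents in the variable [(u - 1)^2] at [l <= 2] are what Jensen's
   inequality needs, with [l = pi((f - 1)^2)]. *)
Lemma sqrM_ln_le (R : realType) (u l : R) : 0 <= u -> 0 <= l <= 2 ->
  u ^+ 2 * ln u <= (2 * u ^+ 3 + 3 * u ^+ 2 - 6 * u + 1) / 6
                   - (2 * l * (u - 1) ^+ 2 - l ^+ 2) / 24.
Proof.
rewrite le_eqVlt => /predU1P[<-|u0] /andP[l0 l2].
  rewrite expr0n mul0r; have := sqr_ge0 (l - 1).
  by rewrite sub0r !expr2 /=; lra.
have x1 : u != 0 by rewrite gt_eqF.
have x3 : 0 < 2 * u + 3 by lra.
have x2 : 2 * u + 3 != 0 by rewrite gt_eqF.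
apply: le_trans (ler_wpM2l (sqr_ge0 u) (ln_le_rat u0)) _.
rewrite [X in X <= _](_ : _ = (2 * u ^+ 3 + 3 * u ^+ 2 - 6 * u + 1) / 6
   - (10 * (u - 1) ^+ 4 / (2 * u + 3)) / 24); last by field; rewrite x1 x2.
rewrite lerD2l lerN2 ler_wpM2r ?invr_ge0 // ler_pdivlMr //.
have v2 := sqr_ge0 (u - 1); set w := (u - 1) ^+ 2 in v2 *.
have -> : (u - 1) ^+ 4 = w ^+ 2 by rewrite /w -exprM.
(* For u <= 7/2 the factor 10 / (2 u + 3) is at least 1 and (w - l)^2 >= 0 suffices; beyond, l <= 2
   bounds the tangent by 4 w, and 10 w >= 4 (2 u + 3). *)
case: (leP u (7/2)) => u7.
  have : (2 * l * w - l ^+ 2) * (2 * u + 3) <= w ^+ 2 * (2 * u + 3).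
    by rewrite ler_pM2r // -subr_ge0 (_ : _ - _ = (w - l) ^+ 2) ?sqr_ge0 //; ring.
  move/le_trans; apply; rewrite mulrC ler_wpM2r ?sqr_ge0 //; lra.
have : (2 * l * w - l ^+ 2) * (2 * u + 3) <= (4 * w) * (2 * u + 3).
  rewrite ler_pM2r //; have := sqr_ge0 l; have : l * w <= 2 * w by rewrite ler_wpM2r.
  by lra.
move/le_trans; apply; rewrite -subr_ge0.
rewrite (_ : _ - _ = w * (10 * w - 4 * (2 * u + 3))); last by ring.
rewrite mulr_ge0 // /w subr_ge0.
have : 0 <= (u - 7/2) * (u + 7/10) by rewrite mulr_ge0 //; lra.
by rewrite !expr2; lra.
Qed.

(** The same cubic from below, for the test functions. At 0 both sides vanish. *)
Lemma sqrM_ln_ge (R : realType) (u : R) : 0 <= u ->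
  (2 * u ^+ 3 + 3 * u ^+ 2 - 6 * u + 1) / 6 - (u - 1) ^+ 4 / 6 <= u ^+ 2 * ln u.
Proof.
rewrite le_eqVlt => /predU1P[<-|u0].
  rewrite [X in _ <= X](_ : _ = 0); last by rewrite expr0n mul0r.
  by rewrite le_eqVlt; apply/orP; left; apply/eqP; field.
have x1 : u != 0 by rewrite gt_eqF.
apply: le_trans (ler_wpM2l (sqr_ge0 u) (ln_ge_rat u0)).
by rewrite le_eqVlt; apply/orP; left; apply/eqP; field.
Qed.

End LnBounds.

(** * The trilinear inequality in frequency space *)

Section Trilinear.
Variables (R : realType) (m : nat).
Hypothesis hn : (4 <= m.+2)%N.
Local Notation n := m.+2.
Implicit Types (j k l : 'Z_n).

(* [r] is the largest of the three word lengths; in case of a two-way tie only one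
   of the two cyclic positions qualifies, otherwise the count in [card_sel] fails
   for odd [n]. *)
Definition dominates (p q r : nat) :=
  ((p <= r) && ((q < r) || ((p == r) && (q == r))))%N.

Lemma dominates_cover p q r :
  [|| dominates p q r, dominates q r p | dominates r p q].
Proof. rewrite /dominates; lia. Qed.

Lemma val_sum3 j k l : j + k + l = 0 -> j != 0 ->
  ((j : nat) + k + l = n \/ (j : nat) + k + l = 2 * n)%N.
Proof.
move=> jkl j0.
have hj : (nat_of_ord j < n)%N := ltn_ord j.
have hk : (nat_of_ord k < n)%N := ltn_ord k.
have hl : (nat_of_ord l < n)%N := ltn_ord l.
have jp : (0 < nat_of_ord j)%N by rewrite lt0n.
have /dvdnP[q hq] : (n %| nat_of_ord j + nat_of_ord k + nat_of_ord l)%N.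
  by move: (congr1 (fun x : 'Z_n => nat_of_ord x) jkl) => /= /eqP; rewrite modnDml.
have : (q < 3)%N.
  by rewrite ltnNge; apply/negP => q3; have := leq_mul q3 (leqnn n); rewrite -hq; lia.
by case: q hq => [|[|[|q]]] //= hq _; move: hq; rewrite ?mul0n ?mul1n; lia.
Qed.

Definition sel j k :=
  [&& j != 0, k != 0, - (j + k) != 0
    & dominates (word_length j) (word_length k) (word_length (- (j + k)))].

(** Otherwise [p] and [q] have signed representatives of opposite signs, and the length of their
    sum, which is that of [r], is smaller than the larger of theirs. *)
Lemma zsum_dominates_same_side (N p q r : nat) :
  (0 < p < N -> 0 < q < N -> 0 < r < N -> p + q + r = N \/ p + q + r = 2 * N ->
  dominates (minn p (N - p)) (minn q (N - q)) (minn r (N - r)) ->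
  (p.*2 < N) && (q.*2 < N) || (N < p.*2) && (N < q.*2))%N.
Proof. rewrite /dominates; lia. Qed.

Lemma Zp_range j : j != 0 -> (0 < nat_of_ord j < n)%N.
Proof. by move=> j0; rewrite lt0n j0 /=; exact: (ltn_ord j). Qed.

Lemma sel_same_side j k : sel j k ->
  ((j.*2 < n) && (k.*2 < n) || (n < j.*2) && (n < k.*2))%N.
Proof.
move=> /and4P[j0 k0 l0 hd].
by apply: zsum_dominates_same_side (Zp_range j0) (Zp_range k0) (Zp_range l0) _ hd;
  exact: val_sum3 (subrr _) j0.
Qed.

Lemma card_ord_range (a b : nat) : (#|[pred j : 'Z_n | a <= j < b]| <= b - a)%N.
Proof.
rewrite cardE -(size_map (fun j : 'Z_n => nat_of_ord j)) -(size_iota a (b - a)).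
apply: uniq_leq_size; first by rewrite map_inj_uniq ?enum_uniq //; exact: val_inj.
move=> x /mapP[j]; rewrite mem_enum inE mem_iota => /andP[aj jb] ->; lia.
Qed.

(* With representatives in [(-N/2, N/2]], [lo_range] collects the [j] of sign
   opposite to [l] (then [|j| + |k| = |l|]) and [hi_range] those of the same sign
   (the triple wraps around). *)
Definition lo_range (N l j : nat) :=
  (if l.*2 <= N then N - minn l (N - l) < j < N else 1 <= j < minn l (N - l))%N.

Definition hi_range (N l j : nat) :=
  (if l.*2 == N then 1 <= j < minn l (N - l)
   else if l.*2 < N then 2 <= j < (minn l (N - l)).+1
   else N - minn l (N - l) <= j < N.-1)%N.

(** A wrapping triple with [p] of length 1 and [r] off N / 2 forces [q] and [r] to have length (N -
    1) / 2. As N > 3 this is a two-way tie, and the tie rule rejects it; hence [hi_range] leaves out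
    1 and N - 1. *)
Lemma zsum_dominates_range (N p q r : nat) :
  (3 < N -> 0 < p < N -> 0 < q < N -> 0 < r < N -> p + q + r = N \/ p + q + r = 2 * N ->
  dominates (minn p (N - p)) (minn q (N - q)) (minn r (N - r)) ->
  lo_range N r p || hi_range N r p)%N.
Proof.
rewrite /dominates /lo_range /hi_range => N3 hp hq hr hs hd.
case: ifP => h1; case: ifP => h2; try case: ifP => h3; lia.
Qed.

(** The admissible [j] are covered by two ranges of at most L - 1 elements each, L being the length
    of [l]. *)
Lemma card_sel l : l != 0 ->
  (#|[pred j | sel j (- (j + l))]| <= 2 * (word_length l).-1)%N.
Proof.
move=> l0; have /andP[lp hl] := Zp_range l0.
pose A := [pred j : 'Z_n | lo_range n l j].
pose B := [pred j : 'Z_n | hi_range n l j].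
apply: (@leq_trans (#|A| + #|B|)).
  rewrite -cardUI (leq_trans _ (leq_addr _ _)) //.
  apply: subset_leq_card; apply/fintype.subsetP => j; rewrite !inE.
  have lE : - (j - (j + l)) = l by rewrite opprB addrAC subrr add0r.
  move=> /and4P[j0 k0 _]; rewrite lE => hd.
  apply: (zsum_dominates_range hn (Zp_range j0) (Zp_range k0) (Zp_range l0) _ hd).
  by apply: val_sum3 j0; rewrite addrAC subrr.
have hA : (#|A| <= (word_length l).-1)%N.
  by rewrite /A /lo_range; case: (l.*2 <= n)%N;
    apply: leq_trans (card_ord_range _ _) _; rewrite /word_length; lia.
have hB : (#|B| <= (word_length l).-1)%N.
  by rewrite /B /hi_range; case: eqP => ?; [|case: ltnP => ?];
    apply: leq_trans (card_ord_range _ _) _; rewrite /word_length; lia.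
lia.
Qed.

(** The involution that exchanges j and l in j + k + l = 0 while k is fixed. *)
Definition opp_sum j k := - (j + k).

Lemma opp_sumK k : involutive (opp_sum^~ k).
Proof. by move=> j; rewrite /opp_sum opprD opprK addrK. Qed.

Lemma oppD_oppD j l : - (j - (l + j)) = l.
Proof. by rewrite addrC; exact: opp_sumK. Qed.

Lemma reindex_opp_sum (F : 'Z_n -> R) k : \sum_j F j = \sum_j F (- (j + k)).
Proof. exact: (reindex_inj (inv_inj (opp_sumK k))). Qed.

(** The rotation (j, k, l) -> (k, l, j) permutes the triples of sum zero. *)
Lemma sum_cyc (F : 'Z_n -> 'Z_n -> R) :
  \sum_j \sum_k F k (- (j + k)) = \sum_j \sum_k F j k.
Proof.
rewrite exchange_big /=; apply: eq_bigr => k _.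
by rewrite [RHS](reindex_opp_sum _ k).
Qed.

Variable a : 'Z_n -> R.
Hypotheses (a_ge0 : forall k, 0 <= a k) (a0 : a 0 = 0) (aN : forall k, a (- k) = a k).

(** Summing first over [j] with l = - (j + k) fixed, each [a l ^+ 2] is counted as often as
    [card_sel] allows. *)
Lemma sum_sel_last :
  \sum_j \sum_k (sel j k)%:R * a (- (j + k)) ^+ 2
    <= 2 * \sum_k ((word_length k)%:R - 1) * a k ^+ 2.
Proof.
under eq_bigr => j _ do rewrite (reindex_opp_sum _ j).
rewrite exchange_big mulr_sumr; apply: ler_sum => l _ /=.
rewrite (eq_bigr (fun j => (sel j (- (l + j)))%:R * a l ^+ 2)); last first.
  by move=> j _; rewrite oppD_oppD.
(* At l = 0 the factor on the right is - 1, which is harmless because [a 0 = 0]. *)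
have [->|l0] := eqVneq l 0.
  by rewrite a0 expr0n !mulr0 big1 // => j _; rewrite mulr0.
rewrite -mulr_suml mulrA ler_wpM2r ?sqr_ge0 // -natr_sum.
have w1 : (0 < word_length l)%N.
  by have := Zp_range l0; rewrite /word_length; lia.
rewrite (_ : _ - 1 = (word_length l).-1%:R); last first.
  by rewrite -subn1 natrB.
rewrite -natrM ler_nat; apply: leq_trans (card_sel l0).
rewrite -sum1_card [X in (_ <= X)%N]big_mkcond /=.
by apply: eq_leq; apply: eq_bigr => j _; rewrite inE addrC; case: (sel _ _).
Qed.

(** Let [P] and [M] be the masses on the two sides of n / 2. Selected pairs lie on one side, so the
    sum is at most P^2 + M^2; evenness gives P = M, and 2 P is at most the total mass. *)
Lemma sum_sel_first :
  \sum_j \sum_k (sel j k)%:R * (a j ^+ 2 * a k ^+ 2) <= (\sum_k a k ^+ 2) ^+ 2 / 2.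
Proof.
pose P := \sum_(k : 'Z_n | (k.*2 < n)%N && (k != 0)) a k ^+ 2.
pose M := \sum_(k : 'Z_n | (n < k.*2)%N) a k ^+ 2.
have PM : P = M.
  rewrite /M (reindex_inj oppr_inj); apply: eq_big => k; last by rewrite aN.
  have [->|k0] := eqVneq k 0; first by rewrite oppr0 andbF.
  have := @val_sum3 k (- k) 0; rewrite subrr addr0 => /(_ erefl k0).
  have h1 := Zp_range k0; have /Zp_range : - k != 0 by rewrite oppr_eq0.
  move: (nat_of_ord k) (nat_of_ord (- k)) h1 => p q /=; lia.
have PMs : P + M <= \sum_k a k ^+ 2.
  rewrite /P /M big_mkcond /= [X in _ + X]big_mkcond /= -big_split /=.
  apply: ler_sum => k _; have := sqr_ge0 (a k).
  case: ifP => [/andP[k1 _]|_]; case: ifP => k2; rewrite ?addr0 ?add0r //; lia.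
have PP : \sum_(j : 'Z_n) \sum_(k : 'Z_n) (((j.*2 < n)%N && (j != 0))%:R * a j ^+ 2) *
     (((k.*2 < n)%N && (k != 0))%:R * a k ^+ 2) = P ^+ 2.
  rewrite expr2 /P [in RHS]big_mkcond /= mulr_suml; apply: eq_bigr => j _.
  by rewrite mulr_sumr; apply: eq_bigr => k _; case: ifP; case: ifP; rewrite ?(mul1r, mul0r, mulr0).
have MM : \sum_(j : 'Z_n) \sum_(k : 'Z_n) ((n < j.*2)%N%:R * a j ^+ 2) * 
    ((n < k.*2)%N%:R * a k ^+ 2) = M ^+ 2.
  rewrite expr2 /M [in RHS]big_mkcond /= mulr_suml; apply: eq_bigr => j _.
  by rewrite mulr_sumr; apply: eq_bigr => k _; case: ifP; case: ifP; rewrite ?(mul1r, mul0r, mulr0).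
apply: (@le_trans _ _ (P ^+ 2 + M ^+ 2)).
  rewrite -PP -MM -big_split /=; apply: ler_sum => j _.
  rewrite -big_split /=; apply: ler_sum => k _.
  have A0 : 0 <= a j ^+ 2 * a k ^+ 2 by rewrite mulr_ge0 ?sqr_ge0.
  rewrite (mulrACA _ (a j ^+ 2)) (mulrACA (_ < _)%N%:R) -!natrM -mulrDl -natrD.
  rewrite ler_wpM2r // ler_nat.
  case E : (sel j k) => //; have := sel_same_side E.
  move/and4P: E => [-> -> _ _]; lia.
have P0 : 0 <= P by rewrite sumr_ge0 // => k _; rewrite sqr_ge0.
rewrite -PM in PMs *.
have := @lerXn2r _ 2 (P + P) (\sum_k a k ^+ 2); rewrite !nnegrE.
move=> /(_ ltac:(lra) ltac:(lra) PMs); rewrite !expr2; lra.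
Qed.

Lemma trilinear_le :
  \sum_j \sum_k a j * a k * a (- (j + k))
    <= 3 * (\sum_k ((word_length k)%:R - 1) * a k ^+ 2) + 3 / 4 * (\sum_k a k ^+ 2) ^+ 2.
Proof.
pose t j k := a j * a k * a (- (j + k)).
pose G j k := (sel j k)%:R * t j k.
have tC j k : t k (- (j + k)) = t j k.
  by rewrite /t oppD_oppD; ring.
have t_ge0 j k : 0 <= t j k by rewrite !mulr_ge0.
have eqN j k : - (k - (j + k)) = j by rewrite opprB addrK.
have eqN2 j k : - (- (j + k) + j) = k by rewrite (addrC j k); exact: opp_sumK.
have tC2 j k : t (- (j + k)) j = t j k by rewrite /t eqN2; ring.
(* Every triple of nonzero frequencies is selected in at least one of its three rotations, whence
   the factor 3 in [cov_sum]. *)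
have covered j k : t j k <= G j k + (G k (- (j + k)) + G (- (j + k)) j).
  rewrite /G tC tC2 -!mulrDl -!natrD -[leLHS]mul1r.
  have [/eqP t0|] := boolP (t j k == 0); first by rewrite t0 !mulr0.
  rewrite !mulf_eq0 !negb_or => /andP[/andP[aj ak] al].
  rewrite ler_wpM2r // (ler_nat _ 1).
  have nz x : a x != 0 -> x != 0 by apply: contraNneq => ->; rewrite a0.
  have := dominates_cover (word_length j) (word_length k) (word_length (- (j + k))).
  rewrite /sel eqN eqN2.
  rewrite (nz _ aj) (nz _ ak) (nz _ al) /=.
  by case: (dominates _ _ _); case: (dominates _ _ _); case: (dominates _ _ _).
have cov_sum : \sum_j \sum_k t j k <= 3 * \sum_j \sum_k G j k.
  apply: (@le_trans _ _ (\sum_j \sum_k (G j k + (G k (- (j + k)) + G (- (j + k)) j)))).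
    by apply: ler_sum => j _; apply: ler_sum => k _.
  under eq_bigr => j _ do rewrite big_split /= big_split /=.
  rewrite big_split /= big_split /= sum_cyc.
  have -> : \sum_j \sum_k G (- (j + k)) j = \sum_j \sum_k G j k.
    rewrite [RHS]exchange_big; apply: eq_bigr => j _ /=.
    by rewrite [RHS](reindex_opp_sum _ j); apply: eq_bigr => k _; rewrite addrC.
  by lra.
apply: le_trans cov_sum _.
have amgm : \sum_j \sum_k G j k <=
    (\sum_j \sum_k (sel j k)%:R * a (- (j + k)) ^+ 2) / 2
    + (\sum_j \sum_k (sel j k)%:R * (a j ^+ 2 * a k ^+ 2)) / 2.
  rewrite !mulr_suml -big_split /=; apply: ler_sum => j _.
  rewrite !mulr_suml -big_split /=; apply: ler_sum => k _.
  rewrite /G /t -!mulrA -mulrDr ler_wpM2l //.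
  have := sqr_ge0 (a j * a k - a (- (j + k))).
  by rewrite !expr2; lra.
(* The constants are 3 * (1/2) * 2 = 3 and 3 * (1/2) * (1/2) = 3/4. *)
have := sum_sel_last; have := sum_sel_first; lra.
Qed.
End Trilinear.

(** * Fourier analysis on the cyclic group *)

Section Expi.
Variable R : realType.
Implicit Types s t : R.

Lemma expi0 : expi 0 = 1 :> R[i].
Proof. by rewrite /expi cos0 sin0. Qed.

Lemma expiD s t : expi (s + t) = expi s * expi t.
Proof. by rewrite /expi cosD sinD; apply/eqP; rewrite eq_complex /= eqxx addrC eqxx. Qed.

Lemma expiMn t k : expi (t *+ k) = expi t ^+ k.
Proof. by elim: k => [|k IH]; rewrite ?mulr0n ?expi0 // mulrS expiD IH exprS. Qed.

Lemma expiN t : expi (- t) = conjc (expi t).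
Proof. by rewrite /expi cosN sinN. Qed.

Lemma expi_neq1 t : 0 < t < 2 * pi -> expi t != 1.
Proof.
move=> /andP[t0 t2]; apply/eqP => -[ct _].
have s0 : 0 < sin (t / 2) by apply: sin_gt0_pi; rewrite divr_gt0 //= ltr_pdivrMr // mulrC.
have := cosD (t / 2) (t / 2); rewrite -splitr ct -!expr2 cos2sin2.
by have := exprn_gt0 2 s0; lra.
Qed.

End Expi.

Section Fourier.
Variables (R : realType) (m : nat).
Local Notation n := m.+2.
Local Notation C := R[i].
Implicit Types (j k l x y : 'Z_n) (f g : 'Z_n -> R).

(** As a power of one root of unity, a character is visibly symmetric in its arguments, and
    reduction modulo n costs only [expi_period]. *)
Definition chi k x : C := expi (2 * pi / n%:R) ^+ (k * x).

Lemma chiE k x : expi (2 * pi * (k : nat)%:R * (x : nat)%:R / n%:R) = chi k x.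
Proof.
rewrite /chi -expiMn; congr expi; rewrite -[RHS]mulr_natr natrM; ring.
Qed.

Lemma expi_period : expi (2 * pi / n%:R : R) ^+ n = 1.
Proof.
rewrite -expiMn -[_ *+ n]mulr_natr divfK ?pnatr_eq0 //.
by rewrite /expi mulrC mulr_natr cos2pi sin2pi.
Qed.

Lemma chiC k x : chi k x = chi x k. Proof. by rewrite /chi mulnC. Qed.

Lemma chi0 x : chi 0 x = 1. Proof. by rewrite /chi mul0n. Qed.

Lemma chiD j k x : chi (j + k) x = chi j x * chi k x.
Proof.
rewrite /chi !exprM -exprMn -exprD; congr (_ ^+ x).
by rewrite /= (expr_mod _ expi_period).
Qed.

Lemma chi_unit k x : chi k x * conjc (chi k x) = 1.
Proof. by rewrite /chi -expiMn -expiN -expiD subrr expi0. Qed.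

Lemma chiN k x : chi (- k) x = conjc (chi k x).
Proof. by rewrite -[LHS]mulr1 -(chi_unit k x) mulrA -chiD addNr chi0 mul1r. Qed.

Lemma chiNN k x : chi (- k) (- x) = chi k x.
Proof. by rewrite chiN chiC chiN chiC conjcK. Qed.

Lemma chiNC k x : chi k (- x) = chi (- k) x.
Proof. by rewrite -chiNN opprK. Qed.

Lemma chi1_neq1 k : k != 0 -> chi k 1 != 1.
Proof.
move=> k0; rewrite -chiE expi_neq1 //= mulr1.
have /andP[k1 k2] := Zp_range k0.
rewrite divr_gt0 ?mulr_gt0 ?pi_gt0 ?ltr0n //=.
by rewrite ltr_pdivrMr ?ltr0n // ltr_pM2l ?mulr_gt0 ?pi_gt0 // ltr_nat.
Qed.

Lemma sum_chi k : \sum_x chi k x = (k == 0)%:R * n%:R.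
Proof.
have [->|k0] := eqVneq k 0.
  rewrite mul1r (eq_bigr (fun=> 1)); last by move=> x _; rewrite chi0.
  by rewrite sumr_const card_ord.
rewrite mul0r; apply/eqP.
(* Translation by 1 multiplies the sum by [chi k 1], which is not 1. *)
have /eqP : \sum_x chi k x = chi k 1 * \sum_x chi k x.
  rewrite {1}(reindex_inj (addrI (1 : 'Z_n))) mulr_sumr; apply: eq_bigr => x _.
  by rewrite chiC chiD !(chiC k).
rewrite -subr_eq0 -{1}[\sum_x _]mul1r -mulrBl mulf_eq0 subr_eq0 eq_sym.
by rewrite (negbTE (chi1_neq1 k0)).
Qed.

Lemma fourierE (h : 'Z_n -> C) k : fourier h k = n%:R^-1 * \sum_x h x * chi (- k) x.
Proof.
by rewrite /fourier; congr (_ * _); apply: eq_bigr => x _; rewrite expiN chiE chiN.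
Qed.

Lemma fourier_inversion (h : 'Z_n -> C) x : h x = \sum_k fourier h k * chi k x.
Proof.
under eq_bigr => k _ do rewrite fourierE -mulrA mulr_suml.
rewrite -mulr_sumr exchange_big /= (bigD1 x) //= [X in _ + X]big1 => [|y yx]; last first.
  rewrite (eq_bigr (fun k => h y * chi (x - y) k)) => [|k _]; last first.
    by rewrite -mulrA chiD (chiC x) (chiC (- y)) chiNC [chi k x * _]mulrC.
  by rewrite -mulr_sumr sum_chi subr_eq0 eq_sym (negbTE yx) mul0r mulr0.
rewrite addr0 (eq_bigr (fun k => h x)) => [|k _]; last first.
  by rewrite chiN -mulrA [conjc _ * _]mulrC chi_unit mulr1.
by rewrite sumr_const card_ord -[h x *+ _]mulr_natl mulKf // pnatr_eq0.
Qed.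

Definition coef f k : C := fourier (fun x => (f x)%:C) k.
Lemma coefE f k : coef f k = n%:R^-1 * \sum_x (f x)%:C * chi (- k) x.
Proof. exact: fourierE. Qed.

Lemma coef_inversion f x : (f x)%:C = \sum_k coef f k * chi k x.
Proof. exact: (fourier_inversion (fun x => (f x)%:C)). Qed.

(** The norm of [R[i]] takes values in [R[i]]; this is the modulus as an element of [R]. *)
Definition amp f k : R := complex.Re `|coef f k|.

Lemma amp_ge0 f k : 0 <= amp f k.
Proof. by rewrite /amp normc_def /= sqrtr_ge0. Qed.

Lemma ampE f k : (amp f k)%:C = `|coef f k|.
Proof. by rewrite /amp normc_def. Qed.

Lemma coefN f k : coef f (- k) = conjc (coef f k).
Proof.
rewrite !coefE rmorphM /= rmorph_sum /= fmorphV /= rmorph_nat; congr (_ * _).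
apply: eq_bigr => x _; rewrite rmorphM; congr (_ * _); last by rewrite /= -chiN.
by rewrite /= oppr0.
Qed.

Lemma ampN f k : amp f (- k) = amp f k.
Proof. by apply: complexI; rewrite !ampE coefN norm_conjC. Qed.

Lemma amp_sqr f k : (amp f k ^+ 2)%:C = coef f k * coef f (- k).
Proof. by rewrite rmorphXn /= ampE sqr_normc coefN. Qed.

Local Notation avg := (fin_integral (unif R n)).

Lemma avgE g : avg g = n%:R^-1 * \sum_x g x.
Proof. by rewrite /fin_integral mulr_sumr. Qed.

Lemma avgC g : (avg g)%:C = n%:R^-1 * \sum_x (g x)%:C.
Proof. by rewrite avgE rmorphM /= fmorphV /= rmorph_nat rmorph_sum. Qed.

Lemma avg_coefM (f g : 'Z_n -> R) : (avg (fun x => f x * g x))%:C = \sum_k coef f k * coef g (- k).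
Proof.
rewrite avgC.
under eq_bigr => x _ do rewrite rmorphM /= (coef_inversion f x) mulr_suml.
rewrite exchange_big mulr_sumr; apply: eq_bigr => k _.
rewrite [coef g _]coefE opprK mulrCA; congr (_ * _).
by rewrite mulr_sumr; apply: eq_bigr => x _; rewrite -mulrA [chi k x * _]mulrC.
Qed.

Lemma avg_sqr f : avg (fun x => f x ^+ 2) = \sum_k amp f k ^+ 2.
Proof.
apply: complexI; rewrite -[avg _]/(avg (fun x => f x * f x)) avg_coefM rmorph_sum.
by apply: eq_bigr => k _; rewrite -amp_sqr.
Qed.

(** Two of the three factors are expanded by inversion; the third, averaged against [chi (j + k)],
    is the coefficient at - (j + k). The triangle inequality does the rest. *)
Lemma avg_cube_le f :
  avg (fun x => f x ^+ 3) <= \sum_j \sum_k amp f j * amp f k * amp f (- (j + k)).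
Proof.
have E : (avg (fun x => f x ^+ 3))%:C = \sum_j \sum_k coef f j * coef f k * coef f (- (j + k)).
  rewrite avgC.
  have E1 x : (f x ^+ 3)%:C = \sum_j \sum_k coef f j * coef f k * ((f x)%:C * chi (j + k) x).
    rewrite exprS expr2 !rmorphM /= {2 3}(coef_inversion f x).
    rewrite big_distrlr /= mulr_sumr; apply: eq_bigr => j _.
    by rewrite mulr_sumr; apply: eq_bigr => k _; rewrite chiD; ring.
  under eq_bigr => x _ do rewrite E1.
  rewrite exchange_big mulr_sumr; apply: eq_bigr => j _.
  rewrite exchange_big mulr_sumr; apply: eq_bigr => k _.
  by rewrite -mulr_sumr mulrCA [coef f (- _)]coefE opprK.
rewrite -lecR; apply: (@le_trans _ _ `|(avg (fun x => f x ^+ 3))%:C|).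
  by rewrite normc_def /= expr0n /= addr0 sqrtr_sqr lecR ler_norm.
rewrite E rmorph_sum; apply: le_trans (ler_norm_sum _ _ _) _; apply: ler_sum => j _.
rewrite rmorph_sum; apply: le_trans (ler_norm_sum _ _ _) _; apply: ler_sum => k _.
by rewrite 2!normrM -!ampE -!rmorphM.
Qed.

Definition form f : R := \sum_k (word_length k)%:R * amp f k ^+ 2.

Lemma dirichlet_form f : dirichlet (fun x => (f x)%:C) = (form f)%:C.
Proof.
rewrite dirichletE rmorph_sum; apply: eq_bigr => k _.
by rewrite rmorphM /= rmorphXn /= ampE rmorph_nat.
Qed.

Lemma coef0 f : coef f 0 = (avg f)%:C.
Proof.
rewrite avgC coefE; congr (_ * _); apply: eq_bigr => x _.
by rewrite oppr0 chi0 mulr1.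
Qed.

Lemma coefB_cst f (c : R) k : k != 0 -> coef (fun x => f x - c) k = coef f k.
Proof.
move=> k0; rewrite !coefE; congr (_ * _).
rewrite (eq_bigr (fun x => (f x)%:C * chi (- k) x - c%:C * chi (- k) x)) => [|x _].
  by rewrite sumrB -mulr_sumr sum_chi oppr_eq0 (negbTE k0) mul0r mulr0 subr0.
by rewrite rmorphB mulrBl.
Qed.

Lemma form_subr_cst f (c : R) : form (fun x => f x - c) = form f.
Proof.
apply: eq_bigr => k _; have [->|k0] := eqVneq k 0.
  by rewrite /word_length min0n !mul0r.
by rewrite /amp coefB_cst.
Qed.

Lemma coefZ f (c : R) k : coef (fun x => c * f x) k = c%:C * coef f k.
Proof.
rewrite !coefE mulrCA; congr (_ * _); rewrite mulr_sumr.
by apply: eq_bigr => x _; rewrite rmorphM mulrA.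
Qed.

Lemma formZ f (c : R) : form (fun x => c * f x) = c ^+ 2 * form f.
Proof.
rewrite /form mulr_sumr; apply: eq_bigr => k _; rewrite (mulrCA (c ^+ 2)); congr (_ * _).
have CM (a b : R) : (a * b)%:C = a%:C * b%:C by rewrite rmorphM.
by apply: complexI; rewrite (CM (c ^+ 2)) !amp_sqr !coefZ rmorphXn; ring.
Qed.

Lemma avg_cube_form (hn : (4 <= n)%N) f : avg f = 0 ->
  avg (fun x => f x ^+ 3)
    <= 3 * (form f - avg (fun x => f x ^+ 2)) + 3 / 4 * avg (fun x => f x ^+ 2) ^+ 2.
Proof.
move=> f0; apply: le_trans (avg_cube_le f) _.
have a0 : amp f 0 = 0 by rewrite /amp coef0 f0 normr0.
apply: le_trans (trilinear_le hn (amp_ge0 f) a0 (ampN f)) _.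
rewrite avg_sqr lerD2r ler_pM2l // le_eqVlt; apply/orP; left; apply/eqP.
by rewrite /form -sumrB; apply: eq_bigr => k _; rewrite mulrBl mul1r.
Qed.

End Fourier.

(** * The Dirichlet form through a nonnegative kernel *)

Section Kernel.
Variables (R : realType) (m : nat).
Local Notation n := m.+2.
Local Notation avg := (fin_integral (unif R n)).
Implicit Types (j k l x y : 'Z_n) (f g : 'Z_n -> R).

Definition half_arc : pred 'Z_n := fun k => (k < n./2)%N.

(** With h the integer part of n / 2, the arc meets its translate in h - k points without wrapping
    and h - (n - k) points with wrapping, in truncated subtraction. Since 2 h <= n, at most one
    count is nonzero. *)
Lemma word_length_arc k :
  (\sum_(r : 'Z_n | half_arc r) half_arc (r + k)%R + word_length k = n./2)%N.
Proof.
have -> : (\sum_(r : 'Z_n | half_arc r) half_arc (r + k)%R =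
    #|[pred r : 'Z_n | 0 <= r < n./2 - k]| + #|[pred r : 'Z_n | n - k <= r < n./2]|)%N.
  rewrite -!sum1_card big_mkcond [X in (_ = X + _)%N]big_mkcond.
  rewrite [X in (_ = _ + X)%N]big_mkcond -big_split /=.
  apply: eq_bigr => r _; rewrite !inE /half_arc /=.
  have kn : (nat_of_ord k < n)%N := ltn_ord k.
  have rn : (nat_of_ord r < n)%N := ltn_ord r.
  have -> : ((r + k) %% n = if r + k < n then r + k else r + k - n)%N.
    case: ltnP => h; first by rewrite modn_small.
    by rewrite -{1}(subnK h) modnDr modn_small //; lia.
  by do ?case: ifP; lia.
have card_range (a b : nat) : (b <= n)%N -> #|[pred r : 'Z_n | (a <= r < b)%N]| = (b - a)%N.
  move=> bn; rewrite cardE -(size_map (fun r : 'Z_n => nat_of_ord r)) -(size_iota a (b - a)).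
  apply: perm_size; apply: uniq_perm; rewrite ?iota_uniq ?map_inj_uniq ?enum_uniq //;
    first exact: val_inj.
  move=> i; rewrite mem_iota; apply/mapP/idP => [[r]|iab].
    by rewrite mem_enum inE => /andP[ar rb] ->; lia.
  have ib : (i < n)%N by lia.
  by exists (Ordinal ib : 'Z_n) => //; rewrite mem_enum inE /=; lia.
have kn : (nat_of_ord k < n)%N := ltn_ord k.
rewrite !card_range /word_length; lia.
Qed.

(** The squared modulus of a character sum over the arc, written by real and imaginary parts so that
    it is a nonnegative real. *)
Definition arc_kernel x y : R :=
  let S := \sum_(q | half_arc q) chi R q (x - y) in
  (n%:R ^+ 2)^-1 * (complex.Re S ^+ 2 + complex.Im S ^+ 2).

Lemma arc_kernel_ge0 x y : 0 <= arc_kernel x y.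
Proof. by rewrite mulr_ge0 ?invr_ge0 ?exprn_ge0 // addr_ge0 ?sqr_ge0. Qed.

(** The Fourier transform of an autocorrelation is a squared modulus. *)
Lemma sum_arc_chi (z : 'Z_n) :
  \sum_k (\sum_(r : 'Z_n | half_arc r) half_arc (r + k)%R)%N%:R * chi R (- k) z
  = `|\sum_(q | half_arc q) chi R q z| ^+ 2.
Proof.
rewrite sqr_normc rmorph_sum big_distrlr /=.
under eq_bigr => k _ do rewrite natr_sum mulr_suml.
rewrite exchange_big /=; apply: eq_bigr => r _.
rewrite (reindex_inj (addIr (- r))) [RHS]big_mkcond /=; apply: eq_bigr => q _.
rewrite addrCA subrr addr0 opprB chiD chiN.
by case: ifP; rewrite ?mul1r ?mul0r.
Qed.

Lemma amp_sqr_sum f k : (amp f k ^+ 2)%:C =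
  \sum_x \sum_y ((f x * f y) / n%:R ^+ 2)%:C * chi R (- k) (x - y).
Proof.
rewrite amp_sqr !coefE opprK mulrACA big_distrlr mulr_sumr /=; apply: eq_bigr => x _.
rewrite mulr_sumr; apply: eq_bigr => y _.
have -> : chi R (- k) (x - y) = chi R (- k) x * chi R k y.
  by rewrite chiC chiD (chiC _ x) (chiC _ (- y)) chiNN.
rewrite !rmorphM /= fmorphV /= rmorphXn /= rmorph_nat expr2 invfM; ring.
Qed.

Lemma arc_kernelE x y : (arc_kernel x y)%:C =
  ((n%:R ^+ 2)^-1)%:C * `|\sum_(q | half_arc q) chi R q (x - y)| ^+ 2.
Proof. by rewrite /arc_kernel -add_Re2_Im2 -rmorphM. Qed.

(** The kernel is nonnegative entry by entry, so the products [f x * f y] can later be estimated one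
    at a time. *)
Lemma formE f : form f =
  (n./2)%:R * avg (fun x => f x ^+ 2) - \sum_x \sum_y arc_kernel x y * (f x * f y).
Proof.
pose N k := (\sum_(r : 'Z_n | half_arc r) half_arc (r + k)%R)%N.
have -> : \sum_x \sum_y arc_kernel x y * (f x * f y) = \sum_k (N k)%:R * amp f k ^+ 2.
  apply: complexI; rewrite rmorph_sum [RHS]rmorph_sum /=.
  under [RHS]eq_bigr => k _ do rewrite rmorphM /= amp_sqr_sum mulr_sumr.
  rewrite exchange_big /=; apply: eq_bigr => x _; rewrite rmorph_sum /=.
  under [RHS]eq_bigr => k _ do rewrite mulr_sumr.
  rewrite exchange_big /=; apply: eq_bigr => y _.
  rewrite [LHS]rmorphM /= arc_kernelE -sum_arc_chi mulr_sumr mulr_suml.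
  apply: eq_bigr => k _; rewrite rmorph_nat !rmorphM /=; ring.
rewrite avg_sqr mulr_sumr -sumrB; apply: eq_bigr => k _.
by rewrite -(word_length_arc k) natrD mulrDl addrC addKr.
Qed.
End Kernel.

(** * Entropy deficit on the cyclic group *)

Section FiniteIntegral.
Variables (R : realType) (T : finType) (nu : T -> R).
Local Notation int := (fin_integral nu).
Implicit Types (f g : T -> R).

Lemma eq_int f g : f =1 g -> int f = int g.
Proof. by move=> fg; apply: eq_bigr => x _; rewrite fg. Qed.

Lemma intD f g : int (fun x => f x + g x) = int f + int g.
Proof. by rewrite -big_split /=; apply: eq_bigr => x _; rewrite mulrDr. Qed.

Lemma intB f g : int (fun x => f x - g x) = int f - int g.
Proof. by rewrite -sumrB /=; apply: eq_bigr => x _; rewrite mulrBr. Qed.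

Lemma intZ (c : R) f : int (fun x => c * f x) = c * int f.
Proof. by rewrite [RHS]mulr_sumr; apply: eq_bigr => x _; rewrite mulrCA. Qed.

Lemma int_sum (I : finType) (F : I -> T -> R) :
  int (fun x => \sum_i F i x) = \sum_i int (F i).
Proof. by rewrite exchange_big /=; apply: eq_bigr => x _; rewrite mulr_sumr. Qed.

Hypothesis nu_ge0 : forall x, 0 <= nu x.

Lemma ler_int f g : (forall x, f x <= g x) -> int f <= int g.
Proof. by move=> fg; apply: ler_sum => x _; rewrite ler_wpM2l. Qed.

Lemma int_ge0 f : (forall x, 0 <= f x) -> 0 <= int f.
Proof. by move=> f0; apply: sumr_ge0 => x _; rewrite mulr_ge0. Qed.

Lemma int_eq0 f g : (forall x, 0 <= f x) -> int f = 0 ->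
  (forall x, f x = 0 -> g x = 0) -> int g = 0.
Proof.
move=> f0 /psumr_eq0P if0 fg; apply: big1 => x _.
have /eqP := if0 (fun x _ => mulr_ge0 (nu_ge0 x) (f0 x)) x isT.
by rewrite mulf_eq0 => /orP[/eqP ->|/eqP /fg ->]; rewrite (mul0r, mulr0).
Qed.

Lemma int_CS f g :
  int (fun x => f x * g x) <= Num.sqrt (int (fun x => f x ^+ 2)) * Num.sqrt (int (fun x => g x ^+ 2)).
Proof.
set p := int (fun x => f x ^+ 2); set q := int (fun x => g x ^+ 2).
have p0 : 0 <= p by apply: int_ge0 => x; rewrite sqr_ge0.
have q0 : 0 <= q by apply: int_ge0 => x; rewrite sqr_ge0.
have [pe|pn] := eqVneq p 0.
  rewrite pe sqrtr0 mul0r (int_eq0 _ pe) // => x; first by rewrite sqr_ge0.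
  by move/eqP; rewrite sqrf_eq0 => /eqP ->; rewrite mul0r.
have [qe|qn] := eqVneq q 0.
  rewrite qe sqrtr0 mulr0 (int_eq0 _ qe) // => x; first by rewrite sqr_ge0.
  by move/eqP; rewrite sqrf_eq0 => /eqP ->; rewrite mulr0.
have ap : 0 < Num.sqrt p by rewrite sqrtr_gt0 lt_def pn.
have bp : 0 < Num.sqrt q by rewrite sqrtr_gt0 lt_def qn.
set a := Num.sqrt p in ap *; set b := Num.sqrt q in bp *.
have pE : p = a ^+ 2 by rewrite sqr_sqrtr.
have qE : q = b ^+ 2 by rewrite sqr_sqrtr.
have : 0 <= int (fun x => (b * f x - a * g x) ^+ 2) by apply: int_ge0 => x; rewrite sqr_ge0.
rewrite (@eq_int _ (fun x => b ^+ 2 * f x ^+ 2 - 2 * a * b * (f x * g x) + a ^+ 2 * g x ^+ 2));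
  last by move=> x; ring.
rewrite intD intB !intZ -/p -/q pE qE => h.
have : 0 <= (2 * a * b) * (a * b - int (fun x => f x * g x))
  by apply: le_trans h _; rewrite le_eqVlt; apply/orP; left; apply/eqP; ring.
by rewrite pmulr_rge0 ?subr_ge0 // !mulr_gt0.
Qed.

Lemma EntZ (k : R) g : 0 <= k -> (forall x, 0 <= g x) -> Ent nu (fun x => k * g x) = k * Ent nu g.
Proof.
rewrite le_eqVlt => /predU1P[<-|k0] g0.
  rewrite /Ent mul0r (@eq_int _ (fun x => 0 * g x)) => [|x]; last by rewrite !mul0r.
  by rewrite intZ !mul0r subr0.
have kln z : 0 <= z -> k * z * ln (k * z) = k * (z * ln z) + (k * ln k) * z.
  rewrite le_eqVlt => /predU1P[<-|z0]; first by rewrite !(mulr0, mul0r) addr0.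
  by rewrite lnM ?posrE //; ring.
rewrite /Ent intZ kln ?int_ge0 //.
rewrite (@eq_int _ (fun x => k * (g x * ln (g x)) + (k * ln k) * g x)) => [|x]; last by rewrite kln.
by rewrite intD !intZ; ring.
Qed.

Hypothesis nu1 : \sum_x nu x = 1.

Lemma int_cst (c : R) : int (fun=> c) = c.
Proof. by rewrite /fin_integral -mulr_suml nu1 mul1r. Qed.

Lemma int_poly3 (a b c d : R) f :
  int (fun x => a * f x ^+ 3 + b * f x ^+ 2 + c * f x + d) =
  a * int (fun x => f x ^+ 3) + b * int (fun x => f x ^+ 2) + c * int f + d.
Proof. by rewrite !intD !intZ int_cst. Qed.

Lemma L2norm_subr1 f : int (fun x => f x ^+ 2) = 1 ->
  L2norm nu (fun x => f x - 1) ^+ 2 = 2 - 2 * int f.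
Proof.
move=> f1; rewrite sqr_sqrtr; last by apply: int_ge0 => x; rewrite sqr_ge0.
rewrite (@eq_int _ (fun x => 0 * f x ^+ 3 + 1 * f x ^+ 2 + (- 2) * f x + 1)) => [|x].
  by rewrite int_poly3 f1; ring.
by rewrite real_normK ?num_real //; ring.
Qed.

End FiniteIntegral.

Section Cyclic.
Variables (R : realType) (m : nat).
Local Notation n := m.+2.
Local Notation avg := (fin_integral (unif R n)).
Implicit Types (f g : 'Z_n -> R).

Lemma unif_ge0 (x : 'Z_n) : 0 <= unif R n x.
Proof. by rewrite /unif invr_ge0. Qed.

Lemma sum_unif : \sum_x unif R n x = 1.
Proof. by rewrite /unif sumr_const card_ord -[_ *+ _]mulr_natl mulfV ?pnatr_eq0. Qed.

Lemma form_ge0 f : 0 <= form f.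
Proof. by apply: sumr_ge0 => k _; rewrite mulr_ge0 ?sqr_ge0. Qed.

Lemma deficit_normalized f : (4 <= n)%N -> (forall x, 0 <= f x) ->
  avg (fun x => f x ^+ 2) = 1 ->
  3^-1 * (1 - avg f) ^+ 2 <= 2 * form f - Ent (unif R n) (fun x => f x ^+ 2).
Proof.
move=> hn f0 f1; set e := avg f.
have P3 := int_poly3 sum_unif.
have e0 : 0 <= e by apply: int_ge0 => // x; exact: unif_ge0.
have e2 : avg (fun x => (f x - e) ^+ 2) = 1 - e ^+ 2.
  rewrite (@eq_int _ _ _ _ (fun x => 0 * f x ^+ 3 + 1 * f x ^+ 2 + (- 2 * e) * f x + e ^+ 2));
  last by move=> x; ring.
  by rewrite P3 f1 -/e; ring.
have e1 : e <= 1.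
  have : 0 <= 1 - e ^+ 2 by rewrite -e2; apply: int_ge0 => x; rewrite ?unif_ge0 ?sqr_ge0.
  by rewrite subr_ge0 expr_le1.
set c3 := avg (fun x => f x ^+ 3).
have e3 : avg (fun x => (f x - e) ^+ 3) = c3 - 3 * e + 2 * e ^+ 3.
  rewrite (@eq_int _ _ _ _ (fun x => 1 * f x ^+ 3 + (- 3 * e) * f x ^+ 2 + (3 * e ^+ 2) * f x + (- e ^+ 3)));
  last by move=> x; ring.
  by rewrite P3 f1 -/e -/c3; ring.
have cube := @avg_cube_form R m hn (fun x => f x - e).
rewrite intB (int_cst sum_unif) subrr form_subr_cst e2 e3 in cube.
have {}cube := cube erefl.
(* This is the mean of (f - 1)^2. Tangency at [l] makes 2 l (f - 1)^2 - l^2 average to exactly l^2,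
   which is Jensen's inequality. *)
pose l := 2 - 2 * e.
have entle : Ent (unif R n) (fun x => f x ^+ 2) <= 2 * ((2 * c3 + 3 - 6 * e + 1) / 6 - l ^+ 2 / 24).
  rewrite /Ent f1 ln1 mulr0 subr0.
  apply: (@le_trans _ _ (avg (fun x => 2 / 3 * f x ^+ 3 + (1 - l / 6) * f x ^+ 2
      + (- 2 + l / 3) * f x + (1 / 3 - l / 6 + l ^+ 2 / 12)))).
    apply: ler_int => [x|x]; first exact: unif_ge0.
    have -> : f x ^+ 2 * ln (f x ^+ 2) = 2 * (f x ^+ 2 * ln (f x)).
      have := f0 x; rewrite le_eqVlt => /predU1P[<-|fx]; first by rewrite expr0n !mul0r mulr0.
      by rewrite lnXn // -[ln _ *+ 2]mulr_natl; ring.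
    have l02 : 0 <= l <= 2 by rewrite /l; lra.
    have h := sqrM_ln_le (f0 x) l02.
    have {h} := ler_wpM2l (ler0n R 2) h; move/le_trans; apply.
    by rewrite le_eqVlt; apply/orP; left; apply/eqP; field.
  rewrite P3 f1 -/e -/c3 /l.
  by rewrite le_eqVlt; apply/orP; left; apply/eqP; field.
(* The term in l^2 contributes (1 - e)^2 / 3, the whole claim; the other terms leave (1 - e)^3 (1 +
   3 e) / 6. *)
have h : 0 <= (1 - e) ^+ 3 * (1 + 3 * e) by rewrite mulr_ge0 ?exprn_ge0 //; lra.
apply: le_trans (lerB (lexx _) entle).
rewrite /l; lra.
Qed.

(** Both sides are homogeneous of degree two, so a nonzero [f] may be normalised. The induction on
    coordinates needs this form, as slice norms are not normalised. *)
Lemma deficit_ge f : (4 <= n)%N -> (forall x, 0 <= f x) ->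
  3^-1 * (Num.sqrt (avg (fun x => f x ^+ 2)) - avg f) ^+ 2
    <= 2 * form f - Ent (unif R n) (fun x => f x ^+ 2).
Proof.
move=> hn f0; set N := Num.sqrt _.
have q0 : 0 <= avg (fun x => f x ^+ 2) by apply: int_ge0 => x; rewrite ?unif_ge0 ?sqr_ge0.
have [q1|q1] := eqVneq (avg (fun x => f x ^+ 2)) 0.
  have sq x : 0 <= f x ^+ 2 by rewrite sqr_ge0.
  have f1 : avg f = 0 by apply: (int_eq0 unif_ge0 sq q1) => x /eqP; rewrite sqrf_eq0 => /eqP.
  have f2 : avg (fun x => f x ^+ 2 * ln (f x ^+ 2)) = 0.
    by apply: (int_eq0 unif_ge0 sq q1) => x ->; rewrite mul0r.
  by rewrite /N /Ent q1 sqrtr0 f1 f2 mul0r !subrr expr0n mulr0 subr0 mulr_ge0 ?form_ge0.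
have Np : 0 < N by rewrite sqrtr_gt0 lt_def q1.
have N0 : 0 <= N^-1 ^+ 2 by rewrite sqr_ge0.
have N2 : avg (fun x => f x ^+ 2) = N ^+ 2 by rewrite sqr_sqrtr.
have sqE : (fun x => (N^-1 * f x) ^+ 2) = (fun x => N^-1 ^+ 2 * f x ^+ 2).
  by apply/funext => x; rewrite exprMn.
have := @deficit_normalized (fun x => N^-1 * f x) hn.
rewrite sqE !intZ N2 formZ (EntZ unif_ge0 N0) => [H|x]; last exact: sqr_ge0.
have {}H : 3^-1 * (1 - N^-1 * avg f) ^+ 2 <=
    2 * (N^-1 ^+ 2 * form f) - N^-1 ^+ 2 * Ent (unif R n) (fun x => f x ^+ 2).
  apply: H => [x|]; first by rewrite mulr_ge0 // invr_ge0 ltW.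
  by rewrite -exprMn mulVf ?expr1n ?gt_eqF.
rewrite -(ler_pM2l (exprn_gt0 2 (etrans (invr_gt0 N) Np))).
rewrite (_ : _ * (3^-1 * _) = 3^-1 * (1 - N^-1 * avg f) ^+ 2); last by field; rewrite gt_eqF.
by rewrite mulrBr (mulrCA _ 2).
Qed.
End Cyclic.

(** * Tensorisation *)

Section Product.
Variables (R : realType) (m : nat).
Local Notation n := m.+2.
Local Notation avg := (fin_integral (unif R n)).
Local Notation G d := {ffun 'I_d -> 'Z_n}.
Local Notation int d := (fin_integral (unif_prod R n d)).

Definition ffun_cons d (y : 'Z_n) (x : G d) : G d.+1 :=
  [ffun j => if unlift ord0 j is Some i then x i else y].

Definition ffun_behead d (z : G d.+1) : G d := [ffun i => z (lift ord0 i)].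

Lemma ffun_cons0 d y (x : G d) : ffun_cons y x ord0 = y.
Proof. by rewrite ffunE unlift_none. Qed.

Lemma ffun_consS d y (x : G d) i : ffun_cons y x (lift ord0 i) = x i.
Proof. by rewrite ffunE liftK. Qed.

Lemma sum_ffun_cons (V : nmodType) d (F : G d.+1 -> V) :
  \sum_z F z = \sum_y \sum_x F (ffun_cons y x).
Proof.
rewrite pair_big /= (reindex (fun p : 'Z_n * G d => ffun_cons p.1 p.2)) //.
exists (fun z : G d.+1 => (z ord0, ffun_behead z)) => [[y x] _|z _] /=.
  by rewrite ffun_cons0; congr (_, _); apply/ffunP => i; rewrite !ffunE liftK.
apply/ffunP => j; rewrite ffunE; case: unliftP => [i ->|->] //.
by rewrite ffunE.
Qed.

Lemma unif_prod_cons d y (x : G d) :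
  unif_prod R n d.+1 (ffun_cons y x) = unif R n y * unif_prod R n d x.
Proof.
by rewrite /unif_prod big_ord_recl.
Qed.

Lemma unif_prod_ge0 d (x : G d) : 0 <= unif_prod R n d x.
Proof. by apply: prodr_ge0 => i _; exact: unif_ge0. Qed.

Lemma int_cons d F : int d.+1 F = avg (fun y => int d (fun x => F (ffun_cons y x))).
Proof.
rewrite /fin_integral sum_ffun_cons; apply: eq_bigr => y _.
by rewrite mulr_sumr; apply: eq_bigr => x _; rewrite unif_prod_cons mulrA.
Qed.

Lemma int_exchange d (F : 'Z_n -> G d -> R) :
  avg (fun y => int d (F y)) = int d (fun x => avg (F^~ x)).
Proof.
rewrite /fin_integral; under eq_bigr => y _ do rewrite mulr_sumr.
rewrite exchange_big; apply: eq_bigr => x _; rewrite mulr_sumr.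
by apply: eq_bigr => y _; rewrite mulrCA.
Qed.

Lemma sum_ffun_ord0 (V : nmodType) (F : G 0 -> V) (z : G 0) : \sum_x F x = F z.
Proof. by rewrite (big_pred1 z) // => x; apply/esym/eqP/ffunP => -[]. Qed.

Lemma int_ord0 F (z : G 0) : int 0 F = F z.
Proof. by rewrite /fin_integral (sum_ffun_ord0 _ z) /unif_prod big_ord0 mul1r. Qed.

Definition z0 : G 0 := [ffun _ => 0].

Lemma sum_unif_prod d : \sum_x unif_prod R n d x = 1.
Proof.
elim: d => [|d IH]; first by rewrite (sum_ffun_ord0 _ z0) /unif_prod big_ord0.
rewrite sum_ffun_cons -(sum_unif R m); apply: eq_bigr => y _.
by under eq_bigr => x _ do rewrite unif_prod_cons; rewrite -mulr_sumr IH mulr1.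
Qed.

(* The real value of the form [int F (A F)], by recursion on the coordinates. *)
Fixpoint prod_form d : (G d -> R) -> R :=
  if d is d'.+1 return (G d -> R) -> R then fun F =>
    int d' (fun x => form (fun y => F (ffun_cons y x)))
    + avg (fun y => prod_form (fun x => F (ffun_cons y x)))
  else fun=> 0.

Lemma lap_coord0 d (F : G d.+1 -> R) y (x : G d) :
  lap_coord ord0 (fun z => (F z)%:C) (ffun_cons y x)
  = lap (fun y' => (F (ffun_cons y' x))%:C) y.
Proof.
rewrite /lap_coord ffun_cons0; congr (lap _ _); apply/funext => y'.
congr ((F _)%:C); apply/ffunP => j; rewrite !ffunE.
by case: unliftP => [i ->|->].
Qed.

Lemma lap_coordS d (F : G d.+1 -> R) y (x : G d) i :
  lap_coord (lift ord0 i) (fun z => (F z)%:C) (ffun_cons y x)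
  = lap_coord i (fun x' => (F (ffun_cons y x'))%:C) x.
Proof.
rewrite /lap_coord ffun_consS; congr (lap _ _); apply/funext => y'.
congr ((F _)%:C); apply/ffunP => j; rewrite !ffunE.
case: unliftP => [k ->|->]; last by [].
by rewrite ffunE (inj_eq lift_inj).
Qed.

Lemma cintegral_lap f :
  fin_cintegral (unif R n) (fun y => (f y)%:C * lap (fun y' => (f y')%:C) y) = (form f)%:C.
Proof.
rewrite -dirichlet_form; apply: eq_bigr => y _; congr (_ * (_ * _)).
exact: (esym (conjc_real _)).
Qed.

Lemma prod_formE d (F : G d -> R) :
  fin_cintegral (unif_prod R n d) (fun x => (F x)%:C * lap_prod (fun y => (F y)%:C) x)
  = (prod_form F)%:C.
Proof.
elim: d F => [|d IH] F.
  rewrite /fin_cintegral (sum_ffun_ord0 _ z0) /lap_prod big_ord0 !mulr0 //.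
rewrite /fin_cintegral sum_ffun_cons.
transitivity (\sum_y \sum_x ((unif_prod R n d x)%:C * ((unif R n y)%:C * ((F (ffun_cons y x))%:C *
    lap (fun y' => (F (ffun_cons y' x))%:C) y))
  + (unif R n y)%:C * ((unif_prod R n d x)%:C * ((F (ffun_cons y x))%:C *
    lap_prod (fun x' => (F (ffun_cons y x'))%:C) x)))).
  apply: eq_bigr => y _; apply: eq_bigr => x _.
  rewrite unif_prod_cons [in LHS]/lap_prod big_ord_recl lap_coord0 /lap_prod.
  under eq_bigr => i _ do rewrite lap_coordS.
  by rewrite rmorphM /=; ring.
under eq_bigr => y _ do rewrite big_split /=.
rewrite big_split /= rmorphD; congr (_ + _).
  rewrite exchange_big rmorph_sum; apply: eq_bigr => x _.
  by rewrite -mulr_sumr [RHS]rmorphM; congr (_ * _); exact: cintegral_lap.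
rewrite rmorph_sum; apply: eq_bigr => y _.
by rewrite -mulr_sumr [RHS]rmorphM; congr (_ * _); exact: IH.
Qed.

(** The chain rule: the slice terms (int F) ln (int F) cancel. *)
Lemma Ent_cons d (F : G d.+1 -> R) :
  Ent (unif_prod R n d.+1) F = Ent (unif R n) (fun y => int d (fun x => F (ffun_cons y x)))
    + avg (fun y => Ent (unif_prod R n d) (fun x => F (ffun_cons y x))).
Proof.
rewrite /Ent intB !int_cons; ring.
Qed.

(** In [formE] the diagonal parts agree by Fubini, and Cauchy-Schwarz on each pair of slices
    compares the kernel parts. *)
Lemma form_contraction d (F : 'Z_n -> G d -> R) :
  form (fun y => Num.sqrt (int d (fun x => F y x ^+ 2))) <= int d (fun x => form (F^~ x)).
Proof.
have s0 y : 0 <= int d (fun x => F y x ^+ 2).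
  by apply: int_ge0 => x; rewrite ?unif_prod_ge0 ?sqr_ge0.
rewrite (@eq_int _ _ _ (fun x => form (F^~ x)) _ (fun x => formE (F^~ x))).
rewrite intB intZ formE; apply: lerB.
  by rewrite -int_exchange ler_wpM2l // (@eq_int _ _ _ _ _ (fun y => sqr_sqrtr (s0 y))).
rewrite int_sum; apply: ler_sum => y _; rewrite int_sum; apply: ler_sum => y' _.
rewrite intZ ler_wpM2l ?arc_kernel_ge0 //.
by apply: int_CS => x; exact: unif_prod_ge0.
Qed.

(* [2 t a - d t^2] is, for the best [t], [a^2 / d]; keeping [t] free makes the
   induction on [d] linear. *)
Lemma prod_deficit_tangent d (F : G d -> R) (t : R) : (4 <= n)%N ->
  (forall x, 0 <= F x) ->
  3^-1 * (2 * t * (Num.sqrt (int d (fun x => F x ^+ 2)) - int d F) - d%:R * t ^+ 2)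
    <= 2 * prod_form F - Ent (unif_prod R n d) (fun x => F x ^+ 2).
Proof.
move=> hn; elim: d F => [|d IH] F F0.
  rewrite /Ent !(int_ord0 _ z0) sqrtr_sqr ger0_norm //= !subrr !(mulr0, mul0r) subr0 mulr0.
  by rewrite ?subrr ?lexx.
rewrite Ent_cons /= !int_cons.
set N := fun y => Num.sqrt (int d (fun x => F (ffun_cons y x) ^+ 2)).
have s0 y : 0 <= int d (fun x => F (ffun_cons y x) ^+ 2).
  by apply: int_ge0 => x; rewrite ?unif_prod_ge0 ?sqr_ge0.
have N2 y : int d (fun x => F (ffun_cons y x) ^+ 2) = N y ^+ 2 by rewrite sqr_sqrtr.
have N2f : (fun y => int d (fun x => F (ffun_cons y x) ^+ 2)) = (fun y => N y ^+ 2).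
  exact/funext.
rewrite N2f.
have H1 := @deficit_ge R m N hn (fun y => sqrtr_ge0 _).
have H2 := @form_contraction d (fun y x => F (ffun_cons y x)).
have H3 : avg (fun y => 3^-1 * (2 * t * (N y - int d (fun x => F (ffun_cons y x))) - d%:R * t ^+ 2))
  <= avg (fun y => 2 * prod_form (fun x => F (ffun_cons y x))
        - Ent (unif_prod R n d) (fun x => F (ffun_cons y x) ^+ 2)).
  by apply: ler_int => [x|y]; [exact: unif_ge0|apply: IH].
rewrite intB !intZ intB intZ intB (int_cst (sum_unif R m)) in H3.
rewrite -/N in H2.
move: H1 H2 H3.
(* The gap a - c splits into a - b, from [H1] in the new coordinate, and b - c, from the slices; (a
   - b - t)^2 >= 0 replaces (a - b)^2 by 2 t (a - b) - t^2. *)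
set a := Num.sqrt _; set b := avg N; set c := avg (fun y => int d _).
move=> H1 H2 H3; have h := sqr_ge0 (a - b - t).
rewrite -[d.+1%:R]natr1; lra.
Qed.

Lemma prod_deficit_ge d (F : G d -> R) : (4 <= n)%N -> (0 < d)%N ->
  (forall x, 0 <= F x) ->
  (3 * d%:R)^-1 * (Num.sqrt (int d (fun x => F x ^+ 2)) - int d F) ^+ 2
    <= 2 * prod_form F - Ent (unif_prod R n d) (fun x => F x ^+ 2).
Proof.
move=> hn d0 F0; have dn : d%:R != 0 :> R by rewrite pnatr_eq0 -lt0n.
set a := _ - _; apply: le_trans (prod_deficit_tangent (a / d%:R) hn F0).
by rewrite -/a le_eqVlt; apply/orP; left; apply/eqP; field.
Qed.

End Product.

(** * Test functions *)

Section TestFunction.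
Variables (R : realType) (m : nat).
Hypothesis hn : (4 <= m.+2)%N.
Local Notation n := m.+2.
Local Notation avg := (fin_integral (unif R n)).

(** This is 2 cos (2 pi x / n). *)
Definition wave (x : 'Z_n) : R := 2 * complex.Re (chi R 1 x).

Lemma waveE x : (wave x)%:C = chi R 1 x + chi R (- 1) x.
Proof. by rewrite chiN addcJ /wave rmorphM /= rmorph_nat. Qed.

Lemma wave_le2 x : `|wave x| <= 2.
Proof.
rewrite /wave normrM ger0_norm // -[leRHS]mulr1 ler_wpM2l // /chi -expiMn /expi /=.
exact: cos_max.
Qed.

Lemma avg_chi (k : 'Z_n) : (n%:R^-1 * \sum_x chi R k x : R[i]) = (k == 0)%:R.
Proof. by rewrite sum_chi mulrCA mulVf ?mulr1 // pnatr_eq0. Qed.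

Lemma Zp2_neq0 : 1 + 1 != 0 :> 'Z_n.
Proof. by move: hn; case: (m) => [|[|k]]. Qed.

Lemma Zp3_neq0 : 1 + 1 + 1 != 0 :> 'Z_n.
Proof. by move: hn; case: (m) => [|[|k]]. Qed.

Lemma avg_wave : avg wave = 0.
Proof.
apply: complexI; rewrite avgC; under eq_bigr => x _ do rewrite waveE.
by rewrite big_split /= mulrDr !avg_chi oppr_eq0 oner_eq0 addr0.
Qed.

(** The cube has only the frequencies 1, 3 and their opposites, nonzero modulo n because n > 3. *)
Lemma avg_wave3 : avg (fun x => wave x ^+ 3) = 0.
Proof.
apply: complexI; rewrite avgC.
rewrite (eq_bigr (fun x => chi R (1 + 1 + 1) x + 3 * chi R 1 x + (3 * chi R (- 1) x
   + chi R (- (1 + 1 + 1)) x))) => [|x _].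
  rewrite !big_split /= -!mulr_sumr !mulrDr !(mulrCA _ 3) !avg_chi.
  by rewrite !oppr_eq0 oner_eq0 (negbTE Zp3_neq0) !mulr0 !addr0.
rewrite rmorphXn /= waveE !opprD !chiD.
have u : chi R 1 x * chi R (- 1) x = 1 by rewrite -chiD subrr chi0.
set a := chi R 1 x in u *; set b := chi R (- 1) x in u *.
transitivity (a * a * a + 3 * a * (a * b) + (3 * b * (a * b) + b * b * b)); first by ring.
by rewrite u; ring.
Qed.

Lemma coef_wave (k : 'Z_n) : coef wave k = ((k == 1) + (k == -1))%:R.
Proof.
rewrite coefE (eq_bigr (fun x => chi R (1 - k) x + chi R (- 1 - k) x)) => [|x _].
  rewrite big_split mulrDr /= !avg_chi natrD; congr (_%:R + _%:R).
    by rewrite subr_eq0 eq_sym.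
  by rewrite subr_eq0 eq_sym.
by rewrite waveE mulrDl !chiD.
Qed.

Lemma amp_wave (k : 'Z_n) : amp wave k ^+ 2 = (k == 1)%:R + (k == -1)%:R.
Proof.
have -> : amp wave k = ((k == 1) + (k == -1))%:R.
  by apply: complexI; rewrite ampE coef_wave normr_nat rmorph_nat.
have [->|_] := eqVneq k 1; last by case: (k == _); rewrite expr2 ?(mulr0, mulr1) ?add0r.
have -> : (1 == -1 :> 'Z_n) = false.
  by apply/negbTE; rewrite -subr_eq0 opprK Zp2_neq0.
by rewrite expr1n addr0.
Qed.

Lemma sum_delta (c : 'Z_n -> R) (l : 'Z_n) : \sum_k c k * (k == l)%:R = c l.
Proof.
rewrite (bigD1 l) //= eqxx mulr1 big1 ?addr0 // => k /negbTE ->; exact: mulr0.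
Qed.

Lemma avg_wave2 : avg (fun x => wave x ^+ 2) = 2.
Proof.
rewrite avg_sqr; under eq_bigr => k _ do rewrite amp_wave -[X in X + _]mul1r -[X in _ + X]mul1r.
by rewrite big_split /= !(sum_delta (fun=> 1)).
Qed.

Lemma form_wave : form wave = 2.
Proof.
rewrite /form; under eq_bigr => k _ do rewrite amp_wave mulrDr.
rewrite big_split /= !(sum_delta (fun k => (word_length k)%:R)) -natrD; congr (_%:R).
have v1 : nat_of_ord (1 : 'Z_n) = 1%N by rewrite /= modn_small.
have vN : nat_of_ord (- 1 : 'Z_n) = n.-1.
  by rewrite /= !modn_small ?subn1.
by move: hn; rewrite /word_length v1 vN; lia.
Qed.

Definition perturbed (eta : R) (x : 'Z_n) := 1 + eta * wave x.

Lemma perturbed_ge0 eta x : 0 <= eta <= 4^-1 -> 0 <= perturbed eta x.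
Proof.
move=> /andP[eta0 eta1].
have := wave_le2 x; rewrite ler_norml => /andP[w1 _].
have : eta * (- 2) <= eta * wave x by rewrite ler_wpM2l.
by rewrite /perturbed; lra.
Qed.

Lemma avg_perturbed eta : avg (perturbed eta) = 1.
Proof. by rewrite intD (int_cst (sum_unif R m)) intZ avg_wave mulr0 addr0. Qed.

Lemma avg_perturbed_sqr eta : avg (fun x => perturbed eta x ^+ 2) = 1 + 2 * eta ^+ 2.
Proof.
rewrite (@eq_int _ _ _ _ (fun x => 0 * wave x ^+ 3 + eta ^+ 2 * wave x ^+ 2 + (2 * eta) * wave x + 1)).
  by rewrite (int_poly3 (sum_unif R m)) avg_wave avg_wave2; ring.
by move=> x; rewrite /perturbed; ring.
Qed.

Lemma form_perturbed eta : form (perturbed eta) = 2 * eta ^+ 2.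
Proof.
have -> : perturbed eta = fun x => eta * wave x - (- 1).
  by apply/funext => x; rewrite opprK addrC.
by rewrite form_subr_cst formZ form_wave mulrC.
Qed.

(** The order eta^2 cancels because [wave] has equal energy and variance, and the order eta^3
    because [avg_wave3] vanishes. The quartic terms add up to 16/3 + 4 <= 10. *)
Lemma deficit_perturbed_le (eta : R) : 0 <= eta <= 4^-1 ->
  2 * form (perturbed eta) - Ent (unif R n) (fun x => perturbed eta x ^+ 2) <= 10 * eta ^+ 4.
Proof.
move=> heta; have /andP[eta0 eta1] := heta.
have P3 := int_poly3 (sum_unif R m).
rewrite form_perturbed; set f := perturbed eta.
have f_ge0 x : 0 <= f x := perturbed_ge0 x heta.
have S0 : 0 <= 2 * eta ^+ 2 by rewrite mulr_ge0 ?sqr_ge0.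
have entlow : 6 * eta ^+ 2 - 16 / 3 * eta ^+ 4 <= avg (fun x => f x ^+ 2 * ln (f x ^+ 2)).
  apply: (@le_trans _ _ (avg (fun x => 2 / 3 * eta ^+ 3 * wave x ^+ 3 + 3 * eta ^+ 2 * wave x ^+ 2
      + 2 * eta * wave x + (- 16 / 3 * eta ^+ 4)))).
    by rewrite P3 avg_wave avg_wave2 avg_wave3 le_eqVlt; apply/orP; left; apply/eqP; field.
  apply: ler_int => [x|x]; first exact: unif_ge0.
  have -> : f x ^+ 2 * ln (f x ^+ 2) = 2 * (f x ^+ 2 * ln (f x)).
    have := f_ge0 x; rewrite le_eqVlt => /predU1P[<-|fx]; first by rewrite expr0n !mul0r mulr0.
    by rewrite lnXn // -[ln _ *+ 2]mulr_natl; ring.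
  apply: le_trans (ler_wpM2l (ler0n R 2) (sqrM_ln_ge (f_ge0 x))).
  have w4 : wave x ^+ 4 <= 16.
    have := wave_le2 x; rewrite ler_norml => /andP[w1 w2].
    have h : 0 <= (2 - wave x) * (2 + wave x) by rewrite mulr_ge0 //; lra.
    have : 0 <= (2 - wave x) * (2 + wave x) * (4 + wave x ^+ 2).
      by rewrite mulr_ge0 // addr_ge0 ?sqr_ge0.
    by rewrite (_ : _ * _ = 16 - wave x ^+ 4) ?subr_ge0 //; ring.
  have h : 0 <= eta ^+ 4 * (16 - wave x ^+ 4) by rewrite mulr_ge0 ?exprn_ge0 ?subr_ge0.
  rewrite -subr_ge0 (_ : _ - _ = eta ^+ 4 * (16 - wave x ^+ 4) / 3).
    by rewrite divr_ge0.
  by rewrite /f /perturbed; field.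
have lnle : (1 + 2 * eta ^+ 2) * ln (1 + 2 * eta ^+ 2) <= (1 + 2 * eta ^+ 2) * (2 * eta ^+ 2).
  by rewrite ler_wpM2l ?le_ln1Dx //; lra.
rewrite /Ent avg_perturbed_sqr.
have := exprn_ge0 4 eta0; lra.
Qed.

(** The normalised [perturbed eta]: dividing by the square root of q = 1 + 2 eta^2 >= 1 divides the
    deficit by q. The mean is recorded through its square. *)
Lemma exists_test (eta : R) : 0 <= eta <= 4^-1 ->
  exists f : 'Z_n -> R, [/\ forall x, 0 <= f x, avg (fun x => f x ^+ 2) = 1,
    0 < avg f, avg f ^+ 2 * (1 + 2 * eta ^+ 2) = 1 &
    2 * form f - Ent (unif R n) (fun x => f x ^+ 2) <= 10 * eta ^+ 4].
Proof.
move=> heta; have D := deficit_perturbed_le heta.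
have /andP[eta0 eta1] := heta.
have f_ge0 x : 0 <= perturbed eta x := perturbed_ge0 x heta.
have f1 := avg_perturbed eta.
have f2 := avg_perturbed_sqr eta.
set f := perturbed eta in D f_ge0 f1 f2.
have S0 : 0 <= 2 * eta ^+ 2 by rewrite mulr_ge0 ?sqr_ge0.
set q := 1 + 2 * eta ^+ 2 in f2 *.
have q1 : 1 <= q by rewrite /q; lra.
have Np : 0 < Num.sqrt q by rewrite sqrtr_gt0; lra.
have N2 : Num.sqrt q ^+ 2 = q by rewrite sqr_sqrtr; lra.
set N := Num.sqrt q in Np N2.
have N0 : 0 <= N^-1 ^+ 2 by rewrite sqr_ge0.
have qn : q != 0 by rewrite gt_eqF //; lra.
have NE : N^-1 ^+ 2 = q^-1 by rewrite exprVn N2.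
have sqE : (fun x => (N^-1 * f x) ^+ 2) = (fun x => N^-1 ^+ 2 * f x ^+ 2).
  by apply/funext => x; rewrite exprMn.
exists (fun x => N^-1 * f x); rewrite sqE; split.
- by move=> x; rewrite mulr_ge0 // invr_ge0 ltW.
- by rewrite intZ f2 NE mulVf.
- by rewrite intZ f1 mulr1 invr_gt0.
- by rewrite intZ f1 mulr1 NE mulVf.
- rewrite formZ (EntZ (@unif_ge0 R m) N0) => [|x]; last exact: sqr_ge0.
  rewrite mulrCA -mulrBr NE; have D0 : 0 <= 10 * eta ^+ 4 by rewrite mulr_ge0 ?exprn_ge0.
  rewrite mulrC ler_pdivrMr; last lra.
  by apply: le_trans D _; rewrite ler_peMr.
Qed.
End TestFunction.

(** * Tensor powers of a normalised function *)

Section ProductTest.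
Variables (R : realType) (m : nat).
Local Notation n := m.+2.
Local Notation avg := (fin_integral (unif R n)).
Local Notation G d := {ffun 'I_d -> 'Z_n}.
Local Notation int d := (fin_integral (unif_prod R n d)).

Lemma prod_formZ d (c : R) (F : G d -> R) : prod_form (fun x => c * F x) = c ^+ 2 * prod_form F.
Proof.
elim: d F => [|d IH] F /=; first by rewrite mulr0.
rewrite mulrDr -!intZ; congr (_ + _); apply: eq_int => y; [exact: formZ|exact: IH].
Qed.

Variable f : 'Z_n -> R.
Hypotheses (f_ge0 : forall x, 0 <= f x) (f2 : avg (fun x => f x ^+ 2) = 1).

Definition tensor d (x : G d) : R := \prod_i f (x i).

Lemma tensor_cons d y (x : G d) : tensor (ffun_cons y x) = f y * tensor x.
Proof.
rewrite /tensor big_ord_recl ffun_cons0; congr (_ * _).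
by apply: eq_bigr => i _; rewrite ffun_consS.
Qed.

Lemma tensor_ge0 d (x : G d) : 0 <= tensor x.
Proof. by apply: prodr_ge0 => i _; exact: f_ge0. Qed.

Lemma int_tensor d : int d (@tensor d) = avg f ^+ d.
Proof.
elim: d => [|d IH]; first by rewrite (int_ord0 _ (z0 m)) /tensor big_ord0.
rewrite int_cons exprS -IH.
transitivity (avg (fun y => int d (@tensor d) * f y)); last by rewrite intZ mulrC.
by apply: eq_int => y; rewrite mulrC -intZ; apply: eq_int => x; exact: tensor_cons.
Qed.

Lemma int_tensor_sqr d : int d (fun x => tensor x ^+ 2) = 1.
Proof.
elim: d => [|d IH]; first by rewrite (int_ord0 _ (z0 m)) /tensor big_ord0 expr1n.
rewrite int_cons -f2; apply: eq_int => y.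
rewrite -[RHS]mulr1 -IH -intZ; apply: eq_int => x.
by rewrite tensor_cons exprMn.
Qed.

Lemma prod_form_tensor d : prod_form (@tensor d) = d%:R * form f.
Proof.
elim: d => [|d IH] /=; first by rewrite mul0r.
rewrite -[d.+1%:R]natr1 mulrDl mul1r addrC -IH; congr (_ + _).
  rewrite -[RHS]mul1r -f2 mulrC -intZ; apply: eq_int => y.
  rewrite mulrC -prod_formZ; congr prod_form; apply/funext => x; exact: tensor_cons.
rewrite -[RHS]mul1r -(int_tensor_sqr d) mulrC -intZ; apply: eq_int => x.
rewrite mulrC -formZ; congr form; apply/funext => y; rewrite tensor_cons; exact: mulrC.
Qed.

Lemma Ent_tensor d : Ent (unif_prod R n d) (fun x => tensor x ^+ 2)
  = d%:R * Ent (unif R n) (fun x => f x ^+ 2).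
Proof.
elim: d => [|d IH].
  by rewrite /Ent !(int_ord0 _ (z0 m)) subrr mul0r.
rewrite Ent_cons -[d.+1%:R]natr1 mulrDl mul1r addrC -IH; congr (_ + _).
  rewrite -[RHS]mul1r -f2 mulrC -intZ; apply: eq_int => y.
  rewrite mulrC -EntZ ?sqr_ge0 //; first by congr Ent; apply/funext => x; rewrite tensor_cons exprMn.
  - exact: unif_prod_ge0.
  - by move=> x; exact: sqr_ge0.
congr Ent; apply/funext => y; rewrite -[RHS]mulr1 -(int_tensor_sqr d) -intZ.
by apply: eq_int => x; rewrite tensor_cons exprMn.
Qed.
End ProductTest.

(** * Optimality and conclusion *)

Lemma deficitC (R : realType) (a b : R) : 2 * a%:C - b%:C = (2 * a - b)%:C :> R[i].
Proof. by rewrite rmorphB rmorphM /= rmorph_nat. Qed.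

Lemma bernoulli_le (R : realType) (x : R) d : 0 <= x -> 1 + d%:R * x <= (1 + x) ^+ d.
Proof.
move=> x0; elim: d => [|d IH]; first by rewrite mul0r addr0.
rewrite exprS; apply: le_trans (ler_wpM2l (addr_ge0 ler01 x0) IH).
rewrite -[d.+1%:R]natr1 -subr_ge0 (_ : _ - _ = d%:R * x ^+ 2); last by ring.
by rewrite mulr_ge0 ?sqr_ge0.
Qed.

Section Main.
Variables (R : realType) (m : nat).
Hypothesis hn : (4 <= m.+2)%N.
Local Notation n := m.+2.
Local Notation avg := (fin_integral (unif R n)).

Lemma exponent_optimal (p c : R) : p < 4 -> 0 < c ->
  exists f : 'Z_n -> R, [/\ forall x, 0 <= f x, avg (fun x => f x ^+ 2) = 1 &
    2 * form f - Ent (unif R n) (fun x => f x ^+ 2)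
      < c * L2norm (unif R n) (fun x => f x - 1) `^ p].
Proof.
move=> p4 c0; have p40 : 0 < 4 - p by lra.
(* [K] solves K^(4 - p) = c / 20. As L <= 2 eta <= K, the deficit is at most 10 L^4 = 10 L^p L^(4 -
   p) <= (c / 2) L^p. *)
pose K := (c / 20) `^ (4 - p)^-1.
have K0 : 0 < K by rewrite powR_gt0 // divr_gt0.
pose eta := Num.min 4^-1 (K / 2).
have eta0 : 0 < eta by rewrite lt_min invr_gt0 ltr0n /= divr_gt0.
have eta4 : eta <= 4^-1 by rewrite ge_min lexx.
have etaK : eta <= K / 2 by rewrite ge_min lexx orbT.
have [|f [f0 f2 a0 aE fD]] := @exists_test R m hn eta; first by rewrite ltW.
exists f; split => //.
have L2 := L2norm_subr1 (@unif_ge0 R m) (sum_unif R m) f2.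
set a := avg f in a0 aE L2.
set L := L2norm _ _ in L2 *.
have L0 : 0 <= L by exact: sqrtr_ge0.
have e2 : 0 < eta ^+ 2 by rewrite exprn_gt0.
have e16 : eta ^+ 2 <= 4^-1 * 4^-1 by rewrite expr2 ler_pM // ltW.
have a2 : 0 < a ^+ 2 by rewrite exprn_gt0.
have a21 : a ^+ 2 < 1 by have := mulr_gt0 a2 e2; lra.
have a1 : a < 1 by move: a21; rewrite expr_lt1 // ltW.
have a12 : 2^-1 <= a ^+ 2.
  have : a ^+ 2 * eta ^+ 2 <= a ^+ 2 * (4^-1 * 4^-1) by rewrite ler_pM2l.
  by lra.
(* L^2 = 2 (1 - a) and 1 - a^2 = 2 a^2 eta^2 make L comparable with eta. *)
have Llow : eta ^+ 2 <= L ^+ 2.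
  have : 2^-1 * eta ^+ 2 <= a ^+ 2 * eta ^+ 2 by rewrite ler_pM2r.
  have : (1 - a) * (1 + a) <= (1 - a) * 2 by rewrite ler_pM2l; lra.
  by rewrite L2; lra.
have Lup : L ^+ 2 <= 4 * eta ^+ 2.
  have : a ^+ 2 * eta ^+ 2 <= 1 * eta ^+ 2 by rewrite ler_pM2r // ltW.
  have : (1 - a) * 1 <= (1 - a) * (1 + a) by rewrite ler_pM2l; lra.
  by rewrite L2; lra.
have Lp : 0 < L.
  by rewrite lt_def L0 andbT; apply: contraTneq (lt_le_trans e2 Llow) => ->; rewrite expr0n ltxx.
have LK : L <= K.
  have : L <= 2 * eta.
    by rewrite -(@ler_pXn2r _ 2) ?nnegrE ?mulr_ge0 ?(ltW eta0) // exprMn -natrX.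
  lra.
have Lpow : L `^ p * L `^ (4 - p) = L ^+ 4.
  by rewrite -powRD ?(gt_eqF Lp) ?implybT // addrC subrK powR_mulrn.
have Lc : L `^ (4 - p) <= c / 20.
  have : L `^ (4 - p) <= K `^ (4 - p) by apply: ge0_ler_powR; rewrite ?nnegrE //; exact: ltW.
  by rewrite /K -powRrM mulVf ?gt_eqF // powRr1 // divr_ge0 // ltW.
have Lpp : 0 < L `^ p by rewrite powR_gt0.
have : eta ^+ 4 <= L ^+ 4.
  by rewrite (exprM _ 2 2) (exprM L 2 2) ler_pXn2r // nnegrE ltW // exprn_gt0.
rewrite -Lpow => h; apply: le_lt_trans fD _.
have : L `^ p * L `^ (4 - p) <= L `^ p * (c / 20) by rewrite ler_pM2l.
have : 0 < c * L `^ p by rewrite mulr_gt0.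
lra.
Qed.

Lemma dimension_optimal (d : nat) : (0 < d)%N ->
  exists F : {ffun 'I_d -> 'Z_n} -> R, [/\ forall x, 0 <= F x,
    fin_integral (unif_prod R n d) (fun x => F x ^+ 2) = 1,
    81^-1 <= L2norm (unif_prod R n d) (fun x => F x - 1) ^+ 4 &
    2 * prod_form F - Ent (unif_prod R n d) (fun x => F x ^+ 2) <= 10 / 256 / d%:R].
Proof.
move=> d0; have dR : 1 <= d%:R :> R by rewrite ler1n.
have dp : 0 < d%:R :> R by lra.
(* With eta^2 of order 1 / d the mean (1 + 2 eta^2)^(- d / 2) of the tensor power stays away from 1,
   while the deficit 10 d eta^4 is of order 1 / d. *)
pose eta : R := Num.sqrt (16 * d%:R)^-1.
have e2 : eta ^+ 2 = (16 * d%:R)^-1 by rewrite sqr_sqrtr // invr_ge0 mulr_ge0 ?ltW.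
have eta4 : 0 <= eta <= 4^-1.
  have h : eta ^+ 2 <= (4^-1) ^+ 2.
    by rewrite e2 exprVn -natrX lef_pV2 ?posrE ?mulr_gt0 //; lra.
  by rewrite sqrtr_ge0 /=; move: h; rewrite ler_pXn2r ?nnegrE ?sqrtr_ge0 ?invr_ge0.
have [f [f0 f2 a0 aE fD]] := @exists_test R m hn eta eta4.
exists (@tensor R m f d); split.
- exact: tensor_ge0.
- exact: int_tensor_sqr.
- have L2 := L2norm_subr1 (@unif_prod_ge0 R m d) (sum_unif_prod R m d) (int_tensor_sqr f2 d).
  rewrite (exprM _ 2 2) L2 int_tensor.
  set b := avg f ^+ d.
  have b0 : 0 < b by rewrite exprn_gt0.
  have bE : b ^+ 2 * (1 + 2 * eta ^+ 2) ^+ d = 1.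
    by rewrite /b -exprM mulnC exprM -exprMn aE expr1n.
  have bern : 9 / 8 <= (1 + 2 * eta ^+ 2) ^+ d.
    apply: le_trans (bernoulli_le _ _); last by rewrite mulr_ge0 ?sqr_ge0.
    by rewrite e2 le_eqVlt; apply/orP; left; apply/eqP; field; rewrite gt_eqF.
  have b98 : b ^+ 2 * (9 / 8) <= 1 by rewrite -[leRHS]bE ler_pM2l ?exprn_gt0.
  (* 17/18 is a rational just above the square root of 8/9; it gives 2 - 2 b >= 1/9. *)
  have b1 : b <= 17 / 18.
    rewrite -(@ler_pXn2r _ 2) ?nnegrE ?(ltW b0) ?divr_ge0 //; apply: (@le_trans _ _ (8/9)); first lra.
    by rewrite expr2; lra.
  have : (9^-1 : R) ^+ 2 <= (2 - 2 * b) ^+ 2 by rewrite ler_pXn2r ?nnegrE //; lra.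
  by rewrite exprVn -natrX.
- rewrite (prod_form_tensor f2) (Ent_tensor f2) (mulrCA 2) -mulrBr.
  apply: le_trans (ler_wpM2l (ltW dp) fD) _.
  rewrite (exprM _ 2 2) e2 le_eqVlt; apply/orP; left; apply/eqP; field.
  by rewrite gt_eqF.
Qed.
End Main.

Theorem theorem5 (R : realType) (n : nat) (hn : (4 <= n)%N) :
  [/\ (* (a) *)
      forall f : 'Z_n -> R,
        (forall x, 0 <= f x) ->
        fin_integral (unif R n) (fun x => f x ^+ 2) = 1 ->
        (12^-1 * L2norm (unif R n) (fun x => f x - 1) ^+ 4)%:C
          <= 2 * dirichlet (fun x => (f x)%:C)
             - (Ent (unif R n) (fun x => f x ^+ 2))%:C,
      (* (b) *)
      forall (d : nat) (f : {ffun 'I_d -> 'Z_n} -> R),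
        (1 <= d)%N ->
        (forall x, 0 <= f x) ->
        fin_integral (unif_prod R n d) (fun x => f x ^+ 2) = 1 ->
        ((12 * d%:R)^-1
           * L2norm (unif_prod R n d) (fun x => f x - 1) ^+ 4)%:C
          <= 2 * fin_cintegral (unif_prod R n d)
                   (fun x => (f x)%:C * lap_prod (fun y => (f y)%:C) x)
             - (Ent (unif_prod R n d) (fun x => f x ^+ 2))%:C,
      (* no exponent p < 4 is possible in (a), whatever the constant *)
      forall p c : R, p < 4 -> 0 < c ->
        ~ (forall f : 'Z_n -> R,
             (forall x, 0 <= f x) ->
             fin_integral (unif R n) (fun x => f x ^+ 2) = 1 ->
             (c * L2norm (unif R n) (fun x => f x - 1) `^ p)%:C
               <= 2 * dirichlet (fun x => (f x)%:C)
                  - (Ent (unif R n) (fun x => f x ^+ 2))%:C)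
    & (* the constants possible in (b) are O(1/d) *)
      exists C : R, forall (d : nat) (c : R), (1 <= d)%N ->
        (forall f : {ffun 'I_d -> 'Z_n} -> R,
           (forall x, 0 <= f x) ->
           fin_integral (unif_prod R n d) (fun x => f x ^+ 2) = 1 ->
           (c * L2norm (unif_prod R n d) (fun x => f x - 1) ^+ 4)%:C
             <= 2 * fin_cintegral (unif_prod R n d)
                      (fun x => (f x)%:C * lap_prod (fun y => (f y)%:C) x)
                - (Ent (unif_prod R n d) (fun x => f x ^+ 2))%:C) ->
        c <= C / d%:R].
Proof.
(* For n = m + 2 the type ['Z_n] is by conversion that of the ordinals below n. *)
case: n hn => [|[|m]] // {}hn; split.
- move=> f f0 f2; rewrite dirichlet_form deficitC lecR.
  apply: le_trans (deficit_normalized hn f0 f2).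
  (* The squared norm is 2 (1 - e), with e the mean of [f], so that 1/12 of its square is (1 - e)^2
     / 3. *)
  rewrite (exprM _ 2 2) (L2norm_subr1 (@unif_ge0 R m) (sum_unif R m) f2).
  by rewrite le_eqVlt; apply/orP; left; apply/eqP; field.
- move=> d F d0 F0 F2; rewrite prod_formE deficitC lecR.
  apply: le_trans (prod_deficit_ge hn d0 F0).
  have dn : d%:R != 0 :> R by rewrite pnatr_eq0 -lt0n.
  rewrite (exprM _ 2 2) (L2norm_subr1 (@unif_prod_ge0 R m d) (sum_unif_prod R m d) F2) F2 sqrtr1.
  by rewrite le_eqVlt; apply/orP; left; apply/eqP; field.
- move=> p c p4 c0 H; have [f [f0 f2]] := exponent_optimal hn p4 c0.
  by have := H f f0 f2; rewrite dirichlet_form deficitC lecR leNgt => /negP.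
(* The test function gives 81 * 10 / 256 < 4. *)
- exists 4 => d c d0 H.
  have dp : 0 < d%:R :> R by rewrite ltr0n.
  have [F [F0 F2 Fl FD]] := @dimension_optimal R m hn d d0.
  have := H F F0 F2; rewrite prod_formE deficitC lecR => /le_trans /(_ FD) h.
  have [c0|c0] := leP c 0; first by apply: le_trans c0 _; rewrite divr_ge0 // ltW.
  have : c * 81^-1 <= 10 / 256 / d%:R by apply: le_trans h; rewrite ler_pM2l.
  have : 0 <= d%:R^-1 :> R by rewrite invr_ge0 ltW.
  by lra.
Qed.
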